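(* Let TcD be the first-order theory, in the language $\{+,R,0,-\}$, of divisible abelian cyclically ordered groups having a nontrivial element of finite order. Then: (1) TcD is complete and model-complete; (2) TcD has the amalgamation property; (3) TcD admits quantifier elimination; (4) the torsion subgroup $T(\mathbb{U})$ of $\mathbb{U}$, with the cyclic order induced from $\mathbb{U}$, is a prime model of TcD; (5) TcD is the model completion of the theory of abelian cyclically ordered groups; in particular every abelian cyclically ordered group admits a c-divisible hull.
   Context: A cyclically ordered group is a group $G$ with a ternary relation $R$ such that: $R(a,b,c)$ implies $a,b,c$ pairwise distinct; $R(a,b,c)$ implies $R(b,c,a)$; for every $g\in G$ the relation $R(g,\cdot,\cdot)$ is a strict linear order on $G\setminus\{g\}$; and $R(a,b,c)$ implies $R(hah',hbh',hch')$ for all $h,h'\in G$. A c-homomorphism $f:(G,R)\to(G',R')$ is a group homomorphism such that $R(a,b,c)$ and $f(a),f(b),f(c)$ pairwise distinct imply $R'(f(a),f(b),f(c))$; c-embeddings and c-isomorphisms are defined accordingly. $\mathbb{U}$ is the group of complex numbers of modulus 1 with $R(e^{i\theta_1},e^{i\theta_2},e^{i\theta_3})$ iff $0\le\theta_{\sigma(1)}<\theta_{\sigma(2)}<\theta_{\sigma(3)}<2\pi$ for some cyclic permutation $\sigma$ of $\{1,2,3\}$ (with $\theta_j\in[0,2\pi)$); $T(\mathbb{U})$ is its torsion subgroup. An abelian cyclically ordered group is c-divisible if it is divisible and contains a subgroup c-isomorphic to $T(\mathbb{U})$. A c-divisible hull of an abelian cyclically ordered group $G$ is a c-divisible abelian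 cyclically ordered group into which $G$ c-embeds and which c-embeds over $G$ into every c-divisible abelian cyclically ordered group into which $G$ c-embeds.
   Formalization: TcD is taken as the theory of c-divisible groups (divisible, containing a copy of T(U)); with only ''a nontrivial element of finite order'' the claim is false: the group of 2-power roots of unity is divisible but has no element of order 3, unlike T(U). *)

(* Defs.v *)
From Stdlib Require Import Reals Lra ProofIrrelevance.
From Coquelicot Require Import Complex.

Set Implicit Arguments.
Unset Strict Implicit.

(** * First-order logic in the language {+, R, 0, -} *)

Record structure : Type := Structure {
  carrier :> Type;
  zero : carrier;
  add : carrier -> carrier -> carrier;
  opp : carrier -> carrier;
  cyc : carrier -> carrier -> carrier -> Prop
}.

Arguments zero {s}.
Arguments add {s} _ _.
Arguments opp {s} _.
Arguments cyc {s} _ _ _.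

(** De Bruijn indices: [Var 0] is bound by the innermost enclosing quantifier,
    and the variables that are not bound are read in a valuation [nat -> M]. *)
Inductive term : Type :=
| Var (n : nat)
| Zero
| Add (s t : term)
| Opp (t : term).

Inductive formula : Type :=
| Eq (s t : term)
| Rel (s t u : term)
| Bot
| Imp (p q : formula)
| And (p q : formula)
| Or (p q : formula)
| All (p : formula)
| Ex (p : formula).

Definition Not (p : formula) : formula := Imp p Bot.
Definition Iff (p q : formula) : formula := And (Imp p q) (Imp q p).

Definition scons (A : Type) (a : A) (v : nat -> A) (n : nat) : A :=
  match n with 0%nat => a | S m => v m end.

Fixpoint eval (M : structure) (v : nat -> M) (t : term) : M :=
  match t with
  | Var n => v n
  | Zero => zero
  | Add s t => add (eval v s) (eval v t)
  | Opp t => opp (eval v t)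
  end.

Fixpoint sat (M : structure) (v : nat -> M) (p : formula) : Prop :=
  match p with
  | Eq s t => eval v s = eval v t
  | Rel s t u => cyc (eval v s) (eval v t) (eval v u)
  | Bot => False
  | Imp p q => sat v p -> sat v q
  | And p q => sat v p /\ sat v q
  | Or p q => sat v p \/ sat v q
  | All p => forall a : M, sat (scons a v) p
  | Ex p => exists a : M, sat (scons a v) p
  end.

Fixpoint occurs (k : nat) (t : term) : Prop :=
  match t with
  | Var n => n = k
  | Zero => False
  | Add s t => occurs k s \/ occurs k t
  | Opp t => occurs k t
  end.

Fixpoint free (k : nat) (p : formula) : Prop :=
  match p with
  | Eq s t => occurs k s \/ occurs k t
  | Rel s t u => occurs k s \/ occurs k t \/ occurs k u
  | Bot => False
  | Imp p q | And p q | Or p q => free k p \/ free k q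
  | All p | Ex p => free (S k) p
  end.

Definition sentence (p : formula) : Prop := forall k : nat, ~ free k p.

Fixpoint quantifier_free (p : formula) : Prop :=
  match p with
  | Eq _ _ | Rel _ _ _ | Bot => True
  | Imp p q | And p q | Or p q => quantifier_free p /\ quantifier_free q
  | All _ | Ex _ => False
  end.

(** For a formula with free variables this is validity of its universal
    closure. *)
Definition holds (M : structure) (p : formula) : Prop :=
  forall v : nat -> M, sat v p.

Definition theory : Type := formula -> Prop.

Definition model (T : theory) (M : structure) : Prop :=
  forall p : formula, T p -> holds M p.

Definition entails (T : theory) (p : formula) : Prop :=
  forall M : structure, model T M -> holds M p.

Definition theory_of (K : structure -> Prop) : theory :=
  fun p => sentence p /\ forall M : structure, K M -> holds M p.

(** * Model-theoretic properties *)

Definition embedding (M N : structure) (f : M -> N) : Prop :=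
  (forall x y : M, f x = f y -> x = y) /\
  f zero = zero /\
  (forall x y : M, f (add x y) = add (f x) (f y)) /\
  (forall x : M, f (opp x) = opp (f x)) /\
  (forall x y z : M, cyc x y z <-> cyc (f x) (f y) (f z)).

Definition elementary_embedding (M N : structure) (f : M -> N) : Prop :=
  forall (p : formula) (v : nat -> M), sat v p <-> sat (fun n => f (v n)) p.

Definition complete (T : theory) : Prop :=
  (exists M : structure, model T M) /\
  forall p : formula, sentence p -> entails T p \/ entails T (Not p).

Definition model_complete (T : theory) : Prop :=
  forall (M N : structure) (f : M -> N),
    model T M -> model T N -> embedding f -> elementary_embedding f.

Definition amalgamation_property (T : theory) : Prop :=
  forall (M0 M1 M2 : structure) (f1 : M0 -> M1) (f2 : M0 -> M2),
    model T M0 -> model T M1 -> model T M2 -> embedding f1 -> embedding f2 ->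
    exists (N : structure) (g1 : M1 -> N) (g2 : M2 -> N),
      model T N /\ embedding g1 /\ embedding g2 /\
      forall x : M0, g1 (f1 x) = g2 (f2 x).

Definition quantifier_elimination (T : theory) : Prop :=
  forall p : formula, exists q : formula,
    quantifier_free q /\ (forall k : nat, free k q -> free k p) /\
    entails T (Iff p q).

Definition prime_model (T : theory) (P : structure) : Prop :=
  model T P /\
  forall M : structure, model T M -> exists f : P -> M, elementary_embedding f.

(** The last clause says that the union of [T'] with the diagram of [M] is
    complete: a model of that union is a model [N] of [T'] together with an
    embedding of [M] into [N], and a sentence with constants naming elements of
    [M] is a formula whose free variables are valued in [M]. *)
Definition model_completion (T' T : theory) : Prop :=
  (forall M : structure, model T' M -> model T M) /\
  (forall M : structure, model T M ->
     exists (N : structure) (f : M -> N), model T' N /\ embedding f) /\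
  (forall (M N1 N2 : structure) (f1 : M -> N1) (f2 : M -> N2),
     model T M -> model T' N1 -> model T' N2 ->
     embedding f1 -> embedding f2 ->
     forall (p : formula) (v : nat -> M),
       sat (fun n => f1 (v n)) p <-> sat (fun n => f2 (v n)) p).

(** * Cyclically ordered groups *)

Definition is_group (G : structure) : Prop :=
  (forall x y z : G, add x (add y z) = add (add x y) z) /\
  (forall x : G, add zero x = x) /\
  (forall x : G, add x zero = x) /\
  (forall x : G, add (opp x) x = zero) /\
  (forall x : G, add x (opp x) = zero).

Definition is_commutative (G : structure) : Prop :=
  forall x y : G, add x y = add y x.

Definition strict_linear_order_on (A : Type) (D : A -> Prop)
    (lt : A -> A -> Prop) : Prop :=
  (forall x : A, D x -> ~ lt x x) /\
  (forall x y z : A, D x -> D y -> D z -> lt x y -> lt y z -> lt x z) /\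
  (forall x y : A, D x -> D y -> x <> y -> lt x y \/ lt y x).

Definition cyclically_ordered_group (G : structure) : Prop :=
  is_group G /\
  (forall a b c : G, cyc a b c -> a <> b /\ b <> c /\ a <> c) /\
  (forall a b c : G, cyc a b c -> cyc b c a) /\
  (forall g : G, strict_linear_order_on (fun x => x <> g) (cyc g)) /\
  (forall a b c h h' : G, cyc a b c ->
     cyc (add (add h a) h') (add (add h b) h') (add (add h c) h')).

Definition abelian_cog (G : structure) : Prop :=
  cyclically_ordered_group G /\ is_commutative G.

Definition c_homomorphism (G H : structure) (f : G -> H) : Prop :=
  (forall x y : G, f (add x y) = add (f x) (f y)) /\
  (forall a b c : G, cyc a b c ->
     f a <> f b -> f b <> f c -> f a <> f c -> cyc (f a) (f b) (f c)).

Definition c_embedding (G H : structure) (f : G -> H) : Prop :=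
  c_homomorphism f /\ forall x y : G, f x = f y -> x = y.

Definition c_isomorphic (G H : structure) : Prop :=
  exists (f : G -> H) (g : H -> G),
    c_homomorphism f /\ c_homomorphism g /\
    (forall x : G, g (f x) = x) /\ (forall y : H, f (g y) = y).

Fixpoint nmul (G : structure) (n : nat) (x : G) : G :=
  match n with 0%nat => zero | S m => add x (nmul m x) end.

Definition finite_order (G : structure) (x : G) : Prop :=
  exists n : nat, n <> 0%nat /\ nmul n x = zero.

Definition divisible (G : structure) : Prop :=
  forall (n : nat) (x : G), n <> 0%nat -> exists y : G, nmul n y = x.

Record subgroup (G : structure) : Type := Subgroup {
  mem :> G -> Prop;
  mem_zero : mem zero;
  mem_add : forall x y : G, mem x -> mem y -> mem (add x y);
  mem_opp : forall x : G, mem x -> mem (opp x)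
}.

Definition induced (G : structure) (P : subgroup G) : structure :=
  {| carrier := {x : G | P x};
     zero := exist _ zero (mem_zero P);
     add := fun x y => exist _ (add (proj1_sig x) (proj1_sig y))
                         (mem_add (proj2_sig x) (proj2_sig y));
     opp := fun x => exist _ (opp (proj1_sig x)) (mem_opp (proj2_sig x));
     cyc := fun x y z => cyc (proj1_sig x) (proj1_sig y) (proj1_sig z) |}.

(** * The unit circle and its torsion subgroup *)

Definition expi (t : R) : C := (cos t, sin t).

Definition circle_order (x y z : C) : Prop :=
  exists a b c : R,
    (0 <= a < 2 * PI)%R /\ (0 <= b < 2 * PI)%R /\ (0 <= c < 2 * PI)%R /\
    x = expi a /\ y = expi b /\ z = expi c /\
    ((a < b < c)%R \/ (b < c < a)%R \/ (c < a < b)%R).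

Lemma Cmod1_neq0 (x : C) : Cmod x = 1%R -> x <> RtoC 0.
Proof. intros H ->; rewrite Cmod_0 in H; lra. Qed.

Lemma Cmod1_mult (x y : C) :
  Cmod x = 1%R -> Cmod y = 1%R -> Cmod (x * y) = 1%R.
Proof. intros Hx Hy; rewrite Cmod_mult, Hx, Hy; lra. Qed.

Lemma Cmod1_inv (x : C) : Cmod x = 1%R -> Cmod (/ x) = 1%R.
Proof.
intros Hx; rewrite Cmod_inv, Hx; [lra | now apply Cmod1_neq0].
Qed.

(** The group is multiplicative: [add] is the product of complex numbers. *)
Definition circle : structure :=
  {| carrier := {z : C | Cmod z = 1%R};
     zero := exist _ (RtoC 1) Cmod_1;
     add := fun x y => exist _ (proj1_sig x * proj1_sig y)%C
                         (Cmod1_mult (proj2_sig x) (proj2_sig y));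
     opp := fun x => exist _ (/ proj1_sig x)%C (Cmod1_inv (proj2_sig x));
     cyc := fun x y z =>
              circle_order (proj1_sig x) (proj1_sig y) (proj1_sig z) |}.

Lemma circle_eq (x y : circle) : proj1_sig x = proj1_sig y -> x = y.
Proof.
destruct x as [x hx], y as [y hy]; simpl; intros ->.
now rewrite (proof_irrelevance _ hx hy).
Qed.

Lemma circle_group : is_group circle.
Proof.
repeat split; intros; apply circle_eq; simpl.
- apply Cmult_assoc.
- apply Cmult_1_l.
- apply Cmult_1_r.
- apply Cinv_l, Cmod1_neq0, proj2_sig.
- apply Cinv_r, Cmod1_neq0, proj2_sig.
Qed.

Lemma circle_comm : is_commutative circle.
Proof. intros x y; apply circle_eq; apply Cmult_comm. Qed.

Section Torsion.

Variables (G : structure) (grp : is_group G) (comm : is_commutative G).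

Lemma finite_order_zero : finite_order (zero : G).
Proof.
destruct grp as (_ & H0l & _).
exists 1%nat; split; [discriminate | apply H0l].
Qed.

Lemma nmul_zero (n : nat) : nmul n (zero : G) = zero.
Proof.
destruct grp as (_ & H0l & _).
induction n as [|n IH]; simpl; [easy | now rewrite IH].
Qed.

Lemma nmul_plus (m n : nat) (x : G) :
  nmul (m + n) x = add (nmul m x) (nmul n x).
Proof.
destruct grp as (HA & H0l & _).
induction m as [|m IH]; simpl; [now rewrite H0l | now rewrite IH, HA].
Qed.

Lemma nmul_mult (m n : nat) (x : G) : nmul (m * n) x = nmul m (nmul n x).
Proof.
induction m as [|m IH]; simpl; [easy | now rewrite nmul_plus, IH].
Qed.

Lemma nmul_add (n : nat) (x y : G) :
  nmul n (add x y) = add (nmul n x) (nmul n y).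
Proof.
destruct grp as (HA & H0l & _).
induction n as [|n IH]; simpl; [now rewrite H0l |].
rewrite IH, <- !HA; f_equal.
now rewrite !HA, (comm y).
Qed.

Lemma finite_order_add (x y : G) :
  finite_order x -> finite_order y -> finite_order (add x y).
Proof.
intros (m & Hm & Hx) (n & Hn & Hy).
exists (m * n)%nat; split.
- now intros [E | E]%PeanoNat.Nat.eq_mul_0.
- rewrite nmul_add, (nmul_mult m n y), Hy, nmul_zero.
  rewrite PeanoNat.Nat.mul_comm, nmul_mult, Hx, nmul_zero.
  now destruct grp as (_ & H0l & _).
Qed.

Lemma finite_order_opp (x : G) : finite_order x -> finite_order (opp x).
Proof.
intros (n & Hn & Hx); exists n; split; [easy |].
destruct grp as (HA & H0l & H0r & HNl & HNr).
rewrite <- (H0r (nmul n (opp x))), <- Hx at 1.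
now rewrite <- nmul_add, HNl, nmul_zero.
Qed.

Definition torsion_subgroup : subgroup G :=
  {| mem := @finite_order G;
     mem_zero := finite_order_zero;
     mem_add := finite_order_add;
     mem_opp := finite_order_opp |}.

End Torsion.

Definition torsion_circle : structure :=
  induced (torsion_subgroup circle_group circle_comm).

(** * c-divisible groups *)

Definition c_divisible (G : structure) : Prop :=
  abelian_cog G /\ divisible G /\
  exists P : subgroup G, c_isomorphic (induced P) torsion_circle.

Definition c_divisible_hull (G H : structure) (i : G -> H) : Prop :=
  c_divisible H /\ c_embedding i /\
  forall (K : structure) (j : G -> K), c_divisible K -> c_embedding j ->
    exists k : H -> K, c_embedding k /\ forall x : G, k (i x) = j x.

Definition Tcog : theory := theory_of abelian_cog.

(** A divisible abelian cyclically ordered group with a nontrivial element of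
    finite order need not contain all of the torsion of the circle, as the
    group of roots of unity of order a power of 2 shows.  Such a group has no
    element of order 3, so these groups do not have a complete theory; the
    condition on elements of finite order is therefore the one in
    [c_divisible]. *)
Definition TcD : theory := theory_of c_divisible.

(* Main.v *)
(** A cyclically ordered abelian group [G] is unwound into the ordered abelian group
    [L = Z * G], addition being twisted by the carry cocycle, so that [G] is [L]
    modulo the cofinal element [(1, 0)]; [G] is c-divisible exactly when [L] is
    divisible.  Hulls and amalgams are built upstairs: the hull of [G] is the
    divisible hull of [L] wound up again, and to amalgamate two extensions of a
    divisible [L0] one extends the canonical partial order of their pushout to a
    total one.

    For quantifier elimination, an atomic formula of [G] amounts to the signs of
    finitely many linear forms with integer coefficients in [L], because a term
    makes a bounded number of turns.  Eliminating a variable as Fourier and Motzkin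
    do turns this into a statement about all formulas: to each formula belong finitely
    many quantifier-free ones whose truth values determine its own, uniformly in
    all c-divisible groups. *)

From Stdlib Require Import Reals Lra Lia ZArith List Classical ClassicalEpsilon.
From Stdlib Require Import PropExtensionality FunctionalExtensionality ProofIrrelevance.
From Coquelicot Require Import Complex.
Require Import Defs.
From mathcomp Require classical_sets.
Import ListNotations.

Set Implicit Arguments.
Unset Strict Implicit.

(* The order obtained by cutting [G] at [zero] is not invariant under translation, and [G] may have
   torsion. Upstairs both defects vanish: division by a positive integer is unique and preserves
   signs. The definition of c-divisibility quantifies over subgroups, while a model of [TcD] is only
   known to satisfy sentences. The class is elementary because the copy of the torsion circle
   matters only through the parts of the unit of [L]: one root of unity of each order, a first-order
   condition, suffices to divide [L], and a divisible [L] contains the rational multiples of its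
   unit, which wind up to the torsion circle. Quantifier elimination compares two structures rather
   than rewriting formulas. If finitely many forms have the same signs in both, a witness on one
   side can be matched on the other; so formulas need no normal form, and the list for a quantified
   formula is computed from the list for its body. Completeness follows because the trivial group
   embeds into every model. *)
Declare Scope grp_scope.
Delimit Scope grp_scope with grp.
Notation "x + y" := (add x y) : grp_scope.
Notation "- x" := (opp x) : grp_scope.
Notation "x - y" := (add x (opp y)) : grp_scope.
Bind Scope grp_scope with carrier.

(** * Abelian groups *)

Class abelian (G : structure) : Prop :=
  Abelian { ab_group : is_group G; ab_comm : is_commutative G }.

Section AbelianGroup.

Context {G : structure} {AG : abelian G}.
Open Scope grp_scope.

Lemma addA (x y z : G) : x + (y + z) = (x + y) + z.
Proof. apply ab_group. Qed.
Lemma addC (x y : G) : x + y = y + x.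
Proof. apply ab_comm. Qed.
Lemma add0l (x : G) : zero + x = x.
Proof. apply ab_group. Qed.
Lemma add0r (x : G) : x + zero = x.
Proof. apply ab_group. Qed.
Lemma addNl (x : G) : - x + x = zero.
Proof. apply ab_group. Qed.
Lemma addNr (x : G) : x - x = zero.
Proof. apply ab_group. Qed.

Lemma addI (x y z : G) : x + y = x + z -> y = z.
Proof.
intros H. rewrite <- (add0l y), <- (add0l z), <- (addNl x), <- !addA. now f_equal.
Qed.

Lemma addACA (x y z t : G) : (x + y) + (z + t) = (x + z) + (y + t).
Proof. rewrite <- !addA. f_equal. rewrite !addA. f_equal. apply addC. Qed.

Lemma oppD (x y : G) : - (x + y) = - x - y.
Proof. apply (@addI (x + y)). now rewrite addACA, !addNr, add0l. Qed.

Lemma opp0 : - (zero : G) = zero.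
Proof. apply (@addI zero). now rewrite addNr, add0l. Qed.

Lemma oppK (x : G) : - - x = x.
Proof. apply (@addI (- x)). now rewrite addNr, addNl. Qed.

(** * Integer multiples and a decision procedure for linear identities *)

Definition zmul (k : Z) (x : G) : G :=
  match k with
  | Z0 => zero
  | Zpos p => nmul (Pos.to_nat p) x
  | Zneg p => - nmul (Pos.to_nat p) x
  end.

Lemma zmul_of_nat (n : nat) (x : G) : zmul (Z.of_nat n) x = nmul n x.
Proof. destruct n as [|n]; simpl; [easy|]. now rewrite SuccNat2Pos.id_succ. Qed.

(** With integers written as differences of naturals, the module laws below reduce to those of
    [nmul] without cases on signs. *)
Lemma zmul_diff (a b : nat) (x : G) :
  zmul (Z.of_nat a - Z.of_nat b) x = nmul a x - nmul b x.
Proof.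
destruct (Nat.le_gt_cases b a) as [H|H].
- replace (Z.of_nat a - Z.of_nat b)%Z with (Z.of_nat (a - b)) by lia.
  rewrite zmul_of_nat.
  replace a with ((a - b) + b)%nat at 2 by lia.
  rewrite (nmul_plus ab_group), <- addA, addNr. now rewrite add0r.
- replace (Z.of_nat a - Z.of_nat b)%Z with (- Z.of_nat (S (b - a - 1)))%Z by lia.
  set (c := (b - a - 1)%nat).
  assert (E : zmul (- Z.of_nat (S c)) x = - nmul (S c) x).
  { simpl. now rewrite SuccNat2Pos.id_succ. }
  rewrite E. replace b with (S c + a)%nat by lia.
  rewrite (nmul_plus ab_group), oppD, addA, (addC (nmul a x)), <- addA, addNr.
  now rewrite add0r.
Qed.

Lemma Z_as_diff (k : Z) : exists a b : nat, k = (Z.of_nat a - Z.of_nat b)%Z.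
Proof. exists (Z.to_nat k), (Z.to_nat (- k)). lia. Qed.

Lemma zmul_plus (k l : Z) (x : G) : zmul (k + l) x = zmul k x + zmul l x.
Proof.
destruct (Z_as_diff k) as (a & b & ->), (Z_as_diff l) as (c & d & ->).
replace (Z.of_nat a - Z.of_nat b + (Z.of_nat c - Z.of_nat d))%Z
  with (Z.of_nat (a + c) - Z.of_nat (b + d))%Z by lia.
now rewrite !zmul_diff, !(nmul_plus ab_group), oppD, addACA.
Qed.

Lemma zmul_add (k : Z) (x y : G) : zmul k (x + y) = zmul k x + zmul k y.
Proof.
destruct (Z_as_diff k) as (a & b & ->).
now rewrite !zmul_diff, !(nmul_add ab_group ab_comm), oppD, addACA.
Qed.

Lemma zmul_1 (x : G) : zmul 1 x = x.
Proof. simpl. apply add0r. Qed.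

Lemma zmul_0r (k : Z) : zmul k zero = zero.
Proof. destruct k; simpl; rewrite ?(nmul_zero ab_group), ?opp0; easy. Qed.

Lemma zmul_opp (k : Z) (x : G) : zmul (- k) x = - zmul k x.
Proof. destruct k; simpl; now rewrite ?opp0, ?oppK. Qed.

Lemma zmul_opp_r (k : Z) (x : G) : zmul k (- x) = - zmul k x.
Proof. apply (@addI (zmul k x)). now rewrite <- zmul_add, !addNr, zmul_0r. Qed.

Lemma zmul_mul (k l : Z) (x : G) : zmul (k * l) x = zmul k (zmul l x).
Proof.
assert (H : forall n : nat, zmul (Z.of_nat n * l) x = nmul n (zmul l x)).
{ induction n as [|n IH]; [easy|].
  replace (Z.of_nat (S n) * l)%Z with (l + Z.of_nat n * l)%Z by lia.
  now rewrite zmul_plus, IH. }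
destruct (Z_as_diff k) as (a & b & ->).
rewrite zmul_diff, <- !H, <- zmul_opp, <- zmul_plus. f_equal. lia.
Qed.

(** Identities between integer linear combinations are decided by comparing the
    coefficients of every atom; these may be arbitrary integer expressions. *)
Inductive aexp : Type :=
| AVar (n : nat)
| AZero
| AAdd (e f : aexp)
| AOpp (e : aexp)
| AMul (k : Z) (e : aexp).

Fixpoint aden (env : list G) (e : aexp) : G :=
  match e with
  | AVar n => nth n env zero
  | AZero => zero
  | AAdd e f => aden env e + aden env f
  | AOpp e => - aden env e
  | AMul k e => zmul k (aden env e)
  end.

Fixpoint acoef (e : aexp) (i : nat) : Z :=
  match e with
  | AVar n => if Nat.eqb n i then 1 else 0
  | AZero => 0
  | AAdd e f => acoef e i + acoef f i
  | AOpp e => - acoef e i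
  | AMul k e => k * acoef e i
  end%Z.

Fixpoint lincomb (f : nat -> Z) (i : nat) (env : list G) : G :=
  match env with
  | [] => zero
  | x :: env => zmul (f i) x + lincomb f (S i) env
  end.

Fixpoint eq_coefs (f g : nat -> Z) (i : nat) (env : list G) : Prop :=
  match env with
  | [] => True
  | _ :: env => f i = g i /\ eq_coefs f g (S i) env
  end.

Lemma lincomb_eq (f g : nat -> Z) (env : list G) (i : nat) :
  eq_coefs f g i env -> lincomb f i env = lincomb g i env.
Proof.
revert i; induction env as [|x env IH]; simpl; intros i; [easy|].
intros [-> H]. now rewrite (IH _ H).
Qed.

(** The first half serves the induction: once the index has passed [n], the coefficients of [AVar n]
    are all zero. *)
Lemma lincomb_var (n i : nat) (env : list G) :
  (forall j, (n < i)%nat -> lincomb (acoef (AVar n)) (i + j) env = zero) /\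
  lincomb (acoef (AVar (i + n))) i env = nth n env zero.
Proof.
revert n i; induction env as [|x env IH]; simpl; intros n i; split; intros.
- easy.
- now destruct n.
- destruct (Nat.eqb_spec n (i + j)) as [E|_]; [lia|].
  simpl. rewrite add0l. replace (S (i + j)) with (i + S j)%nat by lia.
  now apply (IH n i).
- destruct n as [|n].
  + rewrite Nat.add_0_r, Nat.eqb_refl, zmul_1.
    pose proof (proj1 (IH i (S i)) 0%nat) as E.
    rewrite Nat.add_0_r in E. simpl in E |- *. rewrite E by lia. apply add0r.
  + destruct (Nat.eqb_spec (i + S n) i) as [E|_]; [lia|].
    rewrite <- Nat.add_succ_comm. simpl. rewrite add0l. apply (IH n (S i)).
Qed.

Lemma lincomb_add (f g : nat -> Z) (i : nat) (env : list G) :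
  lincomb (fun j => f j + g j)%Z i env = lincomb f i env + lincomb g i env.
Proof.
revert i; induction env as [|x env IH]; simpl; intros i; [now rewrite add0l|].
now rewrite IH, zmul_plus, addACA.
Qed.

Lemma lincomb_mul (k : Z) (f : nat -> Z) (i : nat) (env : list G) :
  lincomb (fun j => k * f j)%Z i env = zmul k (lincomb f i env).
Proof.
revert i; induction env as [|x env IH]; simpl; intros i; [now rewrite zmul_0r|].
now rewrite IH, zmul_mul, zmul_add.
Qed.

Lemma lincomb_opp (f : nat -> Z) (i : nat) (env : list G) :
  lincomb (fun j => - f j)%Z i env = - lincomb f i env.
Proof.
revert i; induction env as [|x env IH]; simpl; intros i; [now rewrite opp0|].
now rewrite IH, zmul_opp, oppD.
Qed.

Lemma aden_lincomb (env : list G) (e : aexp) : aden env e = lincomb (acoef e) 0 env.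
Proof.
induction e as [n| |e IHe f IHf|e IHe|k e IHe]; simpl.
- symmetry; apply (lincomb_var n 0 env).
- generalize 0%nat; induction env as [|x env IH]; simpl; intros i; [easy|].
  now rewrite add0l, <- IH.
- now rewrite IHe, IHf, <- lincomb_add.
- now rewrite IHe, <- lincomb_opp.
- now rewrite IHe, <- lincomb_mul.
Qed.

Lemma aden_eq (env : list G) (e f : aexp) :
  eq_coefs (acoef e) (acoef f) 0 env -> aden env e = aden env f.
Proof. intros H. rewrite !aden_lincomb. now apply lincomb_eq. Qed.

End AbelianGroup.

Ltac atom_insert x env :=
  lazymatch env with
  | @nil ?T => constr:(@cons T x (@nil T))
  | cons x _ => env
  | @cons ?T ?y ?env' => let env'' := atom_insert x env' in constr:(@cons T y env'')
  end.

Ltac atom_index x env :=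
  lazymatch env with
  | cons x _ => constr:(0%nat)
  | cons _ ?env' => let n := atom_index x env' in constr:(S n)
  end.

Ltac atoms e env :=
  lazymatch e with
  | add ?a ?b => let env := atoms a env in atoms b env
  | opp ?a => atoms a env
  | zmul _ ?a => atoms a env
  | nmul _ ?a => atoms a env
  | zero => env
  | _ => atom_insert e env
  end.

Ltac reify_group e env :=
  lazymatch e with
  | add ?a ?b =>
      let a := reify_group a env in let b := reify_group b env in constr:(AAdd a b)
  | opp ?a => let a := reify_group a env in constr:(AOpp a)
  | zmul ?k ?a => let a := reify_group a env in constr:(AMul k a)
  | nmul ?k ?a => let a := reify_group a env in constr:(AMul (Z.of_nat k) a)
  | zero => constr:(AZero)
  | _ => let n := atom_index e env in constr:(AVar n)
  end.

Ltac abel :=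
  intros; rewrite <- ?zmul_of_nat;
  lazymatch goal with
  | |- @eq ?T ?a ?b =>
      let env := atoms a (@nil T) in
      let env := atoms b env in
      let e := reify_group a env in
      let f := reify_group b env in
      apply (aden_eq (env := env) (e := e) (f := f));
      cbv beta iota zeta delta [eq_coefs acoef Nat.eqb];
      repeat split; first [ring | lia | nia]
  end.

(** * Ordered abelian groups *)

(** The order is given by its nonnegative cone; the field [cyc] of the underlying
    structure plays no role. *)
Record ordgroup : Type := Ordgroup {
  og :> structure;
  og_abelian : abelian og;
  pos : og -> Prop;
  pos_add : forall x y : og, pos x -> pos y -> pos (add x y);
  pos_total : forall x : og, pos x \/ pos (opp x);
  pos_anti : forall x : og, pos x -> pos (opp x) -> x = zero
}.

#[global] Existing Instance og_abelian.

Arguments pos {o} _.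

Definition spos (L : ordgroup) (x : L) : Prop := ~ pos (opp x).

Section OrderedGroup.

Variable L : ordgroup.
Implicit Types x y z : L.
Open Scope grp_scope.

Lemma pos_eq x y : pos x -> x = y -> pos y.
Proof. now intros H <-. Qed.

Lemma spos_eq x y : spos x -> x = y -> spos y.
Proof. now intros H <-. Qed.

Lemma pos_zero : pos (zero : L).
Proof. destruct (pos_total (zero : L)) as [H|H]; [easy|]. now rewrite opp0 in H. Qed.

Lemma spos_pos x : spos x -> pos x.
Proof. intros H. now destruct (pos_total x). Qed.

Lemma spos_add x y : spos x -> pos y -> spos (x + y).
Proof. intros Hx Hy H. apply Hx. apply (pos_eq (pos_add H Hy)). abel. Qed.

Lemma spos_zero : ~ spos (zero : L).
Proof. intros H. apply H. rewrite opp0. apply pos_zero. Qed.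

Lemma spos_irrefl x : ~ spos (x - x).
Proof. rewrite addNr. apply spos_zero. Qed.

Lemma pos_or_spos x : pos x \/ spos (- x).
Proof. unfold spos. rewrite oppK. apply classic. Qed.

Lemma spos_anti x : pos x -> spos (- x) -> False.
Proof. intros H K. apply K. now rewrite oppK. Qed.

Lemma spos_neq x : spos x -> x <> zero.
Proof. intros H ->. now apply spos_zero. Qed.

Lemma pos_neq_spos x : pos x -> x <> zero -> spos x.
Proof. intros H K E. apply K. now apply pos_anti. Qed.

Lemma spos_trichotomy x y : x <> y -> spos (y - x) \/ spos (x - y).
Proof.
intros N. destruct (pos_or_spos (y - x)) as [H|H].
- left. apply pos_neq_spos; [easy|]. intros E. apply N.
  apply (@addI _ _ (- x)). rewrite addNl, addC. now symmetry.
- right. apply (spos_eq H). abel.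
Qed.

Lemma pos_zmul k x : (0 <= k)%Z -> pos x -> pos (zmul k x).
Proof.
intros Hk Hx. rewrite <- (Z2Nat.id k Hk), zmul_of_nat.
induction (Z.to_nat k) as [|n IH]; simpl; [apply pos_zero|now apply pos_add].
Qed.

Lemma spos_zmul k x : (0 < k)%Z -> spos x -> spos (zmul k x).
Proof.
intros Hk Hx.
refine (spos_eq (spos_add Hx (pos_zmul (k := k - 1) _ (spos_pos Hx))) _); [lia|abel].
Qed.

Lemma pos_zmul_inv k x : (0 < k)%Z -> pos (zmul k x) -> pos x.
Proof.
intros Hk H. destruct (pos_or_spos x) as [K|K]; [easy|exfalso].
apply (spos_anti H). apply (spos_eq (spos_zmul Hk K)). abel.
Qed.

Lemma zmul_eq0 k x : k <> 0%Z -> zmul k x = zero -> x = zero.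
Proof.
intros Hk E.
assert (E' : zmul (Z.abs k) x = zero).
{ destruct (Z.abs_spec k) as [[_ ->]|[_ ->]]; [easy|].
  rewrite zmul_opp, E. apply opp0. }
apply pos_anti; apply (@pos_zmul_inv (Z.abs k)); try lia.
- rewrite E'. apply pos_zero.
- rewrite zmul_opp_r, E', opp0. apply pos_zero.
Qed.

Lemma zmul_inj k x y : k <> 0%Z -> zmul k x = zmul k y -> x = y.
Proof.
intros Hk E. apply (@addI _ _ (- y)). rewrite addNl.
apply (zmul_eq0 Hk). rewrite zmul_add, E, <- zmul_add, addNl. apply zmul_0r.
Qed.

Lemma spos_zmul_iff k z : spos z -> (spos (zmul k z) <-> (0 < k)%Z).
Proof.
intros Hz. split; [|intros H; now apply spos_zmul].
intros H. destruct (Z.lt_ge_cases 0 k) as [K|K]; [easy|exfalso].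
apply H. rewrite <- zmul_opp. apply pos_zmul; [lia|now apply spos_pos].
Qed.

Lemma pos_zmul_iff k z : spos z -> (pos (zmul k z) <-> (0 <= k)%Z).
Proof.
intros Hz. split; [|intros H; now apply pos_zmul, spos_pos].
intros H. destruct (Z.le_gt_cases 0 k) as [K|K]; [easy|exfalso].
apply (spos_anti H). rewrite <- zmul_opp. apply spos_zmul; [lia|easy].
Qed.

(** A strong order unit. The group itself may be non-Archimedean, yet [floor] works with respect to
    [z]. *)
Definition cofinal z : Prop := forall x, exists k, pos (zmul k z - x).

Lemma floor z x : spos z -> cofinal z ->
  exists k, pos (x - zmul k z) /\ spos (zmul (k + 1) z - x).
Proof.
intros Hz Hc. destruct (Hc x) as [b Hb], (Hc (- x)) as [a Ha].
(* Walk up from a lower bound [c] in steps of [z]; [n] counts the steps left to a strict upper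
   bound. *)
assert (H : forall n c, pos (x - zmul c z) ->
  spos (zmul (c + Z.of_nat n) z - x) ->
  exists k, pos (x - zmul k z) /\ spos (zmul (k + 1) z - x)).
{ induction n as [|n IH]; intros c H1 H2.
  - exfalso. apply (spos_anti H1). apply (spos_eq H2). abel.
  - destruct (pos_or_spos (x - zmul (c + 1) z)) as [K|K].
    + apply (IH (c + 1)%Z K). apply (spos_eq H2). abel.
    + exists c. split; [easy|]. apply (spos_eq K). abel. }
assert (Hab : spos (zmul (b + 1 + a) z)).
{ refine (spos_eq (spos_add Hz (pos_add Ha Hb)) _). abel. }
apply spos_zmul_iff in Hab; [|easy].
apply (H (Z.to_nat (b + 1 + a)) (- a)%Z).
- apply (pos_eq Ha). abel.
- rewrite Z2Nat.id by lia. refine (spos_eq (spos_add Hz Hb) _). abel.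
Qed.

End OrderedGroup.

Definition odivisible (L : ordgroup) : Prop :=
  forall (n : Z) (x : L), (0 < n)%Z -> exists y : L, zmul n y = x.

Definition omono (L1 L2 : ordgroup) (f : L1 -> L2) : Prop :=
  (forall x y : L1, f (add x y) = add (f x) (f y)) /\
  (forall x : L1, pos x <-> pos (f x)).

Section Monomorphisms.

Variables (L1 L2 : ordgroup) (f : L1 -> L2).
Open Scope grp_scope.

Lemma additive_zero (G H : structure) {AG : abelian G} {AH : abelian H} (g : G -> H) :
  (forall x y, g (x + y) = g x + g y) -> g zero = zero.
Proof.
intros A. apply (@addI _ _ (g zero)). now rewrite <- A, !add0r.
Qed.

Lemma additive_opp (G H : structure) {AG : abelian G} {AH : abelian H} (g : G -> H) :
  (forall x y, g (x + y) = g x + g y) -> forall x, g (- x) = - g x.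
Proof.
intros A x. apply (@addI _ _ (g x)). rewrite <- A, !addNr. now apply additive_zero.
Qed.

Lemma additive_zmul (G H : structure) {AG : abelian G} {AH : abelian H} (g : G -> H) :
  (forall x y, g (x + y) = g x + g y) -> forall k x, g (zmul k x) = zmul k (g x).
Proof.
intros A k x.
assert (N : forall n, g (nmul n x) = nmul n (g x)).
{ induction n as [|n IH]; simpl; [now apply additive_zero|]. now rewrite A, IH. }
destruct k; simpl; rewrite <- ?N; [now apply additive_zero|easy|].
now rewrite additive_opp.
Qed.

Hypothesis Hf : omono f.

Lemma omono_spos (x : L1) : spos x <-> spos (f x).
Proof.
destruct Hf as [A P]. unfold spos. rewrite (P (- x)).
now rewrite (additive_opp A).
Qed.

Lemma omono_inj (x y : L1) : f x = f y -> x = y.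
Proof.
intros E. apply NNPP. intros N.
destruct Hf as [A _].
destruct (spos_trichotomy N) as [H|H]; apply omono_spos in H;
  rewrite A, (additive_opp A), E in H; now apply spos_irrefl in H.
Qed.

End Monomorphisms.

(** * Cyclically ordered groups as quotients of ordered groups *)

(** [G] is the line [L] wound around a circle of circumference [z]. *)
Record unwinding (L : ordgroup) (z : L) (G : structure) (p : L -> G) : Prop := {
  uw_spos : spos z;
  uw_cofinal : cofinal z;
  uw_add : forall x y : L, p (add x y) = add (p x) (p y);
  uw_surj : forall a : G, exists x : L, p x = a;
  uw_ker : forall x y : L, p x = p y <-> exists k : Z, x = add y (zmul k z);
  uw_cyc : forall a b c : G, cyc a b c <->
    exists x y t : L, p x = a /\ p y = b /\ p t = c /\
      spos (add y (opp x)) /\ spos (add t (opp y)) /\ spos (add (add x z) (opp t))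
}.

Section Unwinding.

Variables (L : ordgroup) (z : L) (G : structure) (p : L -> G).
Hypothesis U : unwinding z p.
Open Scope grp_scope.

(** The difference would be an integer multiple of [z] lying strictly between [zero] and [z]. *)
Lemma uw_between (x y : L) : p x = p y -> spos (y - x) -> spos (x + z - y) -> False.
Proof.
intros E H K. apply (uw_ker U) in E as [k ->].
assert (H1 : spos (zmul (- k) z)). { apply (spos_eq H). abel. }
assert (H2 : spos (zmul (1 + k) z)). { apply (spos_eq K). abel. }
apply spos_zmul_iff in H1, H2; try apply (uw_spos U). lia.
Qed.

Lemma uw_shift (x : L) (k : Z) : p (x + zmul k z) = p x.
Proof. apply (uw_ker U). now exists k. Qed.

Lemma uw_lift_after (x : L) (a : G) : exists y, p y = a /\ pos (y - x) /\ spos (x + z - y).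
Proof.
destruct (uw_surj U a) as [y <-].
destruct (floor (y - x) (uw_spos U) (uw_cofinal U)) as (k & H & K).
exists (y + zmul (- k) z). split; [apply uw_shift|split].
- apply (pos_eq H). abel.
- apply (spos_eq K). abel.
Qed.

(** The lift of the first point may be prescribed, since all three lifts can be moved by the same
    multiple of [z]. *)
Lemma uw_cyc_at (x : L) (b c : G) : cyc (p x) b c <->
  exists y t : L, p y = b /\ p t = c /\
    spos (y - x) /\ spos (t - y) /\ spos (x + z - t).
Proof.
rewrite (uw_cyc U). split.
- intros (x' & y & t & E & <- & <- & H1 & H2 & H3).
  apply (uw_ker U) in E as [k ->].
  exists (y + zmul (- k) z), (t + zmul (- k) z).
  repeat split; try apply uw_shift.
  + apply (spos_eq H1). abel.
  + apply (spos_eq H2). abel.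
  + apply (spos_eq H3). abel.
- intros (y & t & H). now exists x, y, t.
Qed.

Lemma uw_lift_unique (x y t : L) : p y = p t ->
  spos (y - x) -> spos (x + z - y) -> spos (t - x) -> spos (x + z - t) -> y = t.
Proof.
intros E H1 H2 H3 H4. apply NNPP. intros N.
destruct (spos_trichotomy N) as [H|H].
- apply (@uw_between y t E H). refine (spos_eq (spos_add H4 (spos_pos H1)) _). abel.
- apply (@uw_between t y (eq_sym E) H).
  refine (spos_eq (spos_add H2 (spos_pos H3)) _). abel.
Qed.

Lemma uw_abelian : is_group G -> abelian G.
Proof.
intros HG. split; [easy|]. intros a b.
destruct (uw_surj U a) as [x <-], (uw_surj U b) as [y <-].
rewrite <- !(uw_add U). f_equal. apply addC.
Qed.

(** The relation [cyc (p x)] is the order of the open interval from [x] to [x + z], on which [p] is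
    injective. A rotation replaces the lift [x] by [x + z], and translations lift to
    translations. *)
Lemma uw_cog : is_group G -> abelian_cog G.
Proof.
intros HG. split; [|apply (uw_abelian HG)].
split; [easy|split; [|split; [|split]]].
- intros a b c (x & y & t & <- & <- & <- & H1 & H2 & H3)%(uw_cyc U).
  split; [|split]; intros E.
  + apply (uw_between E H1). refine (spos_eq (spos_add H2 (spos_pos H3)) _). abel.
  + apply (uw_between E H2). refine (spos_eq (spos_add H1 (spos_pos H3)) _). abel.
  + apply (uw_between E); [|easy].
    refine (spos_eq (spos_add H1 (spos_pos H2)) _). abel.
- intros a b c (x & y & t & <- & <- & <- & H1 & H2 & H3)%(uw_cyc U).
  apply (uw_cyc U). exists y, t, (x + z). repeat split; try easy.
  + rewrite <- (zmul_1 z). apply uw_shift.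
  + apply (spos_eq H1). abel.
- intros g. destruct (uw_surj U g) as [x <-]. split; [|split].
  + intros b _ (y & t & <- & E & H1 & H2 & H3)%uw_cyc_at.
    apply (@uw_between y t); [easy|easy|].
    refine (spos_eq (spos_add H1 (spos_pos H3)) _). abel.
  + intros b c d _ _ _ (y & t & <- & <- & H1 & H2 & H3)%uw_cyc_at.
    intros (t' & u & E & <- & H4 & H5 & H6)%uw_cyc_at.
    assert (t' = t) as ->.
    { apply (@uw_lift_unique x); try easy.
      - refine (spos_eq (spos_add H5 (spos_pos H6)) _). abel.
      - refine (spos_eq (spos_add H1 (spos_pos H2)) _). abel. }
    apply uw_cyc_at. exists y, u. repeat split; try easy.
    refine (spos_eq (spos_add H2 (spos_pos H5)) _). abel.
  + intros b c Hb Hc N.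
    assert (S : forall a, a <> p x ->
      exists y, p y = a /\ spos (y - x) /\ spos (x + z - y)).
    { intros a Ha. destruct (uw_lift_after x a) as (y & E & H & K).
      exists y. repeat split; try easy. apply pos_neq_spos; [easy|].
      intros F. apply Ha. rewrite <- E. f_equal.
      apply (@addI _ _ (- x)). rewrite addNl, addC. easy. }
    destruct (S b Hb) as (y & <- & H1 & H2), (S c Hc) as (t & <- & H3 & H4).
    assert (N' : y <> t) by congruence.
    destruct (spos_trichotomy N') as [H|H]; [left|right]; apply uw_cyc_at.
    * now exists y, t.
    * now exists t, y.
- intros a b c h h' (x & y & t & <- & <- & <- & H1 & H2 & H3)%(uw_cyc U).
  destruct (uw_surj U h) as [u <-], (uw_surj U h') as [v <-].
  apply (uw_cyc U). exists (u + x + v), (u + y + v), (u + t + v).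
  rewrite !(uw_add U). repeat split; try easy.
  + apply (spos_eq H1). abel.
  + apply (spos_eq H2). abel.
  + apply (spos_eq H3). abel.
Qed.

End Unwinding.

Lemma cog_abelian (G : structure) : abelian_cog G -> abelian G.
Proof. intros [H C]. split; [apply H|easy]. Qed.

(** To reflect [cyc], use that the order around a point is total: if a triple fails downstairs, the
    opposite triple holds, and its image contradicts asymmetry in [H]. *)
Lemma c_embedding_embedding (G H : structure) (f : G -> H) :
  abelian_cog G -> abelian_cog H -> c_embedding f -> embedding f.
Proof.
intros HG HH [[A C] I].
pose proof (cog_abelian HG) as AG. pose proof (cog_abelian HH) as AH.
split; [exact I|split; [|split; [|split]]].
- now apply additive_zero.
- exact A.
- now apply additive_opp.
- destruct HG as [(_ & DG & RG & LG & _) _], HH as [(_ & DH & RH & LH & _) _].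
  assert (F : forall x y t, cyc x y t -> cyc (f x) (f y) (f t)).
  { intros x y t K. destruct (DG _ _ _ K) as (N1 & N2 & N3).
    apply C; auto; intros E; apply I in E; congruence. }
  intros x y t. split; [apply F|]. intros K.
  destruct (DH _ _ _ K) as (N1 & N2 & N3).
  destruct (LG x) as (_ & _ & T).
  destruct (T y t) as [K'|K']; try congruence. exfalso. apply F in K'.
  destruct (LH (f x)) as (Irr & Tr & _).
  apply (Irr (f y)); [congruence|].
  apply (Tr _ (f t)); congruence.
Qed.

Lemma embedding_c_embedding (G H : structure) (f : G -> H) :
  embedding f -> c_embedding f.
Proof.
intros (I & _ & A & _ & C). split; [split|]; auto. intros; now apply C.
Qed.

Lemma unwinding_embedding (L1 L2 : ordgroup) (z1 : L1) (z2 : L2) (G1 G2 : structure)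
    (p1 : L1 -> G1) (p2 : L2 -> G2) (f : L1 -> L2) :
  unwinding z1 p1 -> unwinding z2 p2 -> is_group G1 -> is_group G2 ->
  omono f -> f z1 = z2 ->
  exists g : G1 -> G2, embedding g /\ forall x, g (p1 x) = p2 (f x).
Proof.
intros U1 U2 H1 H2 Hf E.
pose proof (proj1 Hf) as A.
pose (s := fun a => proj1_sig (constructive_indefinite_description _ (uw_surj U1 a))).
assert (Hs : forall a, p1 (s a) = a) by (intros a; apply proj2_sig).
(* From left to right this makes [g] independent of the chosen preimage, from right to left it makes
   [g] injective. *)
assert (K : forall x y, p1 x = p1 y <-> p2 (f x) = p2 (f y)).
{ intros x y. rewrite (uw_ker U1), (uw_ker U2). split; intros [k Hk]; exists k.
  - rewrite Hk, A, (additive_zmul A). now rewrite E.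
  - apply (omono_inj Hf). rewrite Hk, A, (additive_zmul A). now rewrite E. }
pose (g := fun a => p2 (f (s a))).
assert (Hg : forall x, g (p1 x) = p2 (f x)).
{ intros x. apply K, Hs. }
exists g. split; [|easy].
apply c_embedding_embedding; [exact (uw_cog U1 H1)|exact (uw_cog U2 H2)|].
split; [split|].
- intros a b. rewrite <- (Hs a), <- (Hs b), <- (uw_add U1), !Hg, A.
  apply (uw_add U2).
- intros a b c (x & y & t & <- & <- & <- & K1 & K2 & K3)%(uw_cyc U1) _ _ _.
  rewrite !Hg. apply (uw_cyc U2). exists (f x), (f y), (f t).
  repeat split.
  + now rewrite <- (additive_opp A), <- A, <- (omono_spos Hf).
  + now rewrite <- (additive_opp A), <- A, <- (omono_spos Hf).
  + now rewrite <- (additive_opp A), <- E, <- !A, <- (omono_spos Hf).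
- intros a b. rewrite <- (Hs a), <- (Hs b), !Hg. apply K.
Qed.

(** ** Rieger's unwinding *)

#[local] Arguments Z.add : simpl never.
#[local] Arguments Z.sub : simpl never.
#[local] Arguments Z.opp : simpl never.

Section Rieger.

Variable G : structure.
Hypothesis HG : abelian_cog G.
Open Scope grp_scope.

Let AG : abelian G := cog_abelian HG.
#[local] Existing Instance AG.

(** The circle cut open at [zero], with [zero] as least element. *)
Definition below (a b : G) : Prop := cyc zero a b \/ (a = zero /\ b <> zero).

Definition ind (P : Prop) : Z := if excluded_middle_informative P then 1%Z else 0%Z.

Lemma ind_iff (P Q : Prop) : (P <-> Q) -> ind P = ind Q.
Proof.
unfold ind. intros H.
destruct (excluded_middle_informative P), (excluded_middle_informative Q); tauto.
Qed.

Lemma ind_true (P : Prop) : P -> ind P = 1%Z.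
Proof. unfold ind. now destruct (excluded_middle_informative P). Qed.

Lemma ind_false (P : Prop) : ~ P -> ind P = 0%Z.
Proof. unfold ind. now destruct (excluded_middle_informative P). Qed.

(** As with residues modulo an integer, a sum has passed [zero] exactly when it has dropped below a
    summand. *)
Definition carry (a b : G) : Z := ind (below (a + b) a).

Lemma cyc_distinct (a b c : G) : cyc a b c -> a <> b /\ b <> c /\ a <> c.
Proof. apply HG. Qed.

Lemma cyc_rot (a b c : G) : cyc a b c -> cyc b c a.
Proof. apply HG. Qed.

Lemma cyc_trans (g a b c : G) : cyc g a b -> cyc g b c -> cyc g a c.
Proof.
intros H K. destruct (cyc_distinct H) as (? & ? & ?), (cyc_distinct K) as (? & ? & ?).
pose proof HG as [(_ & _ & _ & O & _) _]. destruct (O g) as (_ & T & _).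
apply (T a b c); congruence.
Qed.

Lemma cyc_asym (g a b : G) : cyc g a b -> cyc g b a -> False.
Proof.
intros H K. pose proof (cyc_trans H K) as J. apply cyc_distinct in J. tauto.
Qed.

Lemma cyc_total (g a b : G) : a <> g -> b <> g -> a <> b -> cyc g a b \/ cyc g b a.
Proof.
intros H K N. pose proof HG as [(_ & _ & _ & O & _) _].
destruct (O g) as (_ & _ & T). now apply T.
Qed.

Lemma cyc_translate (a b c h : G) : cyc a b c <-> cyc (a + h) (b + h) (c + h).
Proof.
pose proof HG as [(_ & _ & _ & _ & T) _]. split; intros H.
- apply (T _ _ _ zero h) in H. now rewrite !add0l in H.
- apply (T _ _ _ zero (- h)) in H. rewrite !add0l in H.
  now rewrite <- !addA, !addNr, !add0r in H.
Qed.

Lemma below_irrefl (a : G) : ~ below a a.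
Proof. intros [H|H]; [apply cyc_distinct in H|]; tauto. Qed.

Lemma below_0r (a : G) : ~ below a zero.
Proof. intros [H|H]; [apply cyc_distinct in H|]; tauto. Qed.

Lemma below_0l (a : G) : below zero a <-> a <> zero.
Proof.
split; [|now right]. intros [H|H]; [apply cyc_distinct in H|]; tauto.
Qed.

Lemma below_trans (a b c : G) : below a b -> below b c -> below a c.
Proof.
intros [H|[-> H]] K.
- destruct K as [K|[-> K]]; [left; now apply (cyc_trans H)|].
  apply cyc_distinct in H. tauto.
- apply below_0l. intros ->. now apply below_0r in K.
Qed.

Lemma below_total (a b : G) : below a b \/ a = b \/ below b a.
Proof.
destruct (classic (a = b)) as [E|E]; [tauto|].
destruct (classic (a = zero)) as [->|Ha].
{ left. apply below_0l. congruence. }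
destruct (classic (b = zero)) as [->|Hb].
{ right; right. now apply below_0l. }
destruct (cyc_total Ha Hb E) as [H|H]; [left|right; right]; now left.
Qed.

Lemma below_cyc (a b : G) : a <> zero -> below a b <-> cyc zero a b.
Proof. intros H. unfold below. tauto. Qed.

Lemma below_cyc3 (a b c : G) : below a b -> below b c -> cyc a b c.
Proof.
intros [H|[-> H]] K.
- apply below_cyc in K; [|intros ->; now apply cyc_distinct in H].
  apply cyc_rot, cyc_rot. apply (@cyc_trans b c zero a).
  + now apply cyc_rot.
  + now apply cyc_rot, cyc_rot.
- now apply below_cyc in K.
Qed.

(** Cutting at [zero] loses nothing: a triple is positively oriented when some rotation of it is
    increasing. The opposite orientation, excluded by asymmetry, accounts for the other three
    arrangements. *)
Lemma cyc_below (a b c : G) : cyc a b c <->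
  (below a b /\ below b c) \/ (below b c /\ below c a) \/ (below c a /\ below a b).
Proof.
split.
- intros H. pose proof (cyc_distinct H) as N.
  assert (K : ~ cyc a c b) by (intros K; now apply (cyc_asym H)).
  assert (K1 : ~ (below a c /\ below c b)) by (intros []; now apply K, below_cyc3).
  assert (K2 : ~ (below c b /\ below b a)).
  { intros []. apply K, cyc_rot, cyc_rot. now apply below_cyc3. }
  assert (K3 : ~ (below b a /\ below a c)).
  { intros []. apply K, cyc_rot. now apply below_cyc3. }
  destruct (below_total a b), (below_total b c), (below_total a c); tauto.
- intros [[H K]|[[H K]|[H K]]].
  + now apply below_cyc3.
  + now apply cyc_rot, cyc_rot, below_cyc3.
  + now apply cyc_rot, below_cyc3.
Qed.

Lemma below_asym (a b : G) : below a b -> below b a -> False.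
Proof. intros H K. exact (below_irrefl (below_trans H K)). Qed.

(** Changing the base point of the order from [zero] to [p]. *)
Lemma ind_below_sub (p q r : G) :
  (ind (below (r - p) (q - p)) =
   ind (below q p) + ind (below r q) - ind (below r p))%Z.
Proof.
assert (E : below (r - p) (q - p) <-> cyc p r q \/ (r = p /\ q <> p)).
{ unfold below. rewrite (cyc_translate zero _ _ p), add0l, <- !addA, !addNl, !add0r.
  assert (Z : forall x, x - p = zero <-> x = p).
  { intros x. split; [|intros ->; apply addNr]. intros H.
    rewrite <- (add0r x), <- (addNl p), addA, H. apply add0l. }
  now rewrite !Z. }
rewrite (ind_iff E), (ind_iff (or_iff_compat_r _ (cyc_below p r q))). clear E.
pose proof (@below_asym p q). pose proof (@below_asym r q).
pose proof (@below_asym r p).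
pose proof (@below_irrefl p). pose proof (@below_irrefl q).
pose proof (@below_trans p q r). pose proof (@below_trans q p r).
pose proof (@below_trans p r q). pose proof (@below_trans r p q).
pose proof (@below_trans r q p). pose proof (@below_trans q r p).
destruct (below_total p q) as [?|[?|?]], (below_total r q) as [?|[?|?]];
  destruct (below_total r p) as [?|[?|?]]; subst; try tauto;
  unfold ind; repeat destruct (excluded_middle_informative _); try lia; try tauto;
  exfalso; intuition congruence.
Qed.

Lemma opp_below (a b : G) : a <> zero -> below a b -> below (- a) (- b) -> False.
Proof.
intros Ha H K. apply below_cyc in H; [|easy].
assert (Ha' : - a <> zero) by (intros E; apply Ha; now rewrite <- (oppK a), E, opp0).
apply below_cyc in K; [|easy].
assert (S : forall x y, cyc zero x y -> below (- y) (x - y) /\ below (y - x) (- x)).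
{ intros x y C. split; left.
  - apply (cyc_translate _ _ _ (- y)) in C. rewrite add0l, addNr in C.
    now apply cyc_rot, cyc_rot.
  - apply (cyc_translate _ _ _ (- x)) in C. rewrite add0l, addNr in C.
    now apply cyc_rot. }
destruct (S _ _ H) as [H1 H2], (S _ _ K) as [H3 H4].
rewrite !oppK in H3, H4.
assert (E1 : - b + a = a - b) by apply addC.
assert (E2 : - a + b = b - a) by apply addC.
rewrite E1 in H4. rewrite E2 in H3.
(* The contradiction is the cycle [a < b < b - a < - a < - b < a - b < a]. *)
apply (@below_asym a (a - b)); [|easy].
apply (below_trans (b := b)); [now left|].
apply (below_trans H3), (below_trans H2).
apply (below_trans (b := - b)); [now left|easy].
Qed.

(** Take [- a] as the base point in [ind_below_sub]: for nonzero [a] there is a carry unless [b] is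
    below [- a]. In this form the symmetry of [carry] rests on [opp_below]. *)
Lemma carry_below_opp (a b : G) :
  carry a b = (ind (a <> zero) - ind (below b (- a)))%Z.
Proof.
unfold carry.
pose proof (ind_below_sub (- a) zero b) as E.
rewrite oppK, add0l, (addC b) in E. rewrite E.
rewrite (ind_false (@below_0r b)), (ind_iff (below_0l (- a))).
assert (N : - a <> zero <-> a <> zero).
{ split; intros H K; apply H; [rewrite K; apply opp0|].
  now rewrite <- (oppK a), K, opp0. }
rewrite (ind_iff N). lia.
Qed.

Lemma carryC (a b : G) : carry a b = carry b a.
Proof.
assert (C0 : forall x, carry zero x = 0%Z).
{ intros x. unfold carry. rewrite add0l. apply ind_false, below_0r. }
assert (D0 : forall x, carry x zero = 0%Z).
{ intros x. unfold carry. rewrite add0r. apply ind_false, below_irrefl. }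
destruct (classic (a = zero)) as [->|Ha]; [now rewrite C0, D0|].
destruct (classic (b = zero)) as [->|Hb]; [now rewrite C0, D0|].
rewrite !carry_below_opp, (ind_true Ha), (ind_true Hb). f_equal.
assert (S : forall x y, x <> zero -> y <> zero -> below x (- y) -> below y (- x)).
{ intros x y Hx Hy H. destruct (below_total y (- x)) as [K|[K|K]]; [easy| |].
  - exfalso. rewrite K, oppK in H. now apply below_irrefl in H.
  - exfalso. apply (opp_below Hx H). now rewrite oppK. }
apply ind_iff. split; auto.
Qed.

(** This is the change of base point [ind_below_sub] at [a], [a + b], [a + b + c]. *)
Lemma carry_cocycle (a b c : G) :
  (carry a b + carry (a + b) c = carry b c + carry a (b + c))%Z.
Proof.
unfold carry. rewrite addA.
pose proof (ind_below_sub a (a + b) (a + b + c)) as E.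
assert (E1 : a + b + c - a = b + c) by abel.
assert (E2 : a + b - a = b) by abel.
rewrite E1, E2 in E. lia.
Qed.

Lemma carry_range (a b : G) : (0 <= carry a b <= 1)%Z.
Proof. unfold carry, ind. destruct (excluded_middle_informative _); lia. Qed.

Lemma carry_0l (a : G) : carry zero a = 0%Z.
Proof. unfold carry. rewrite add0l. apply ind_false, below_0r. Qed.

Lemma carry_opp (a : G) : carry a (- a) = ind (a <> zero).
Proof. unfold carry. rewrite addNr. apply ind_iff, below_0l. Qed.

(** The pair [(k, a)] is the point above [a] in turn [k]. The correction in [opp] is there because a
    nonzero [a] and [- a] together make one full turn. *)
Definition rieger_structure : structure :=
  {| carrier := Z * G;
     zero := (0%Z, zero);
     add := fun x y => ((fst x + fst y + carry (snd x) (snd y))%Z, add (snd x) (snd y));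
     opp := fun x => ((- fst x - carry (snd x) (opp (snd x)))%Z, opp (snd x));
     cyc := fun _ _ _ => False |}.

Lemma rieger_abelian : abelian rieger_structure.
Proof.
assert (C : is_commutative rieger_structure).
{ intros [k a] [l b]. simpl. f_equal; [|apply addC]. rewrite carryC. lia. }
assert (Z : forall x : rieger_structure, zero + x = x).
{ intros [k a]. simpl. rewrite add0l, carry_0l. f_equal. lia. }
assert (N : forall x : rieger_structure, x - x = zero).
{ intros [k a]. simpl. rewrite addNr. f_equal. lia. }
split; [split; [|split; [|split; [|split]]]|easy].
- intros [k a] [l b] [m c]. simpl. f_equal; [|apply addA].
  pose proof (carry_cocycle a b c). lia.
- exact Z.
- intros x. rewrite (C x zero). apply Z.
- intros x. rewrite (C (- x) x). apply N.
- exact N.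
Qed.

(** The order is lexicographic, and [zero] is least in each turn, so the number of turns alone
    decides which points are nonnegative. *)
Definition rieger : ordgroup.
Proof.
refine {| og := rieger_structure; og_abelian := rieger_abelian;
          pos := fun x => (0 <= fst x)%Z |}.
- intros [k a] [l b]. simpl. pose proof (carry_range a b). lia.
- intros [k a]. simpl. pose proof (carry_range a (- a)). lia.
- intros [k a]. simpl. rewrite carry_opp. unfold ind.
  destruct (excluded_middle_informative (a <> zero)) as [H|H]; [lia|].
  intros H1 H2. f_equal; [lia|]. now apply NNPP.
Defined.

Definition rieger_unit : rieger := (1%Z, zero).

Local Notation mk k a := ((k%Z, a) : carrier (og rieger)) (only parsing).

Lemma rieger_addE (k l : Z) (a b : G) :
  mk k a + mk l b = ((k + l + carry a b)%Z, a + b).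
Proof. reflexivity. Qed.

Lemma rieger_add_unit (x : rieger) (k : Z) :
  x + zmul k rieger_unit = ((fst x + k)%Z, snd x).
Proof.
assert (E : forall k, zmul k rieger_unit = (k, zero)).
{ assert (N : forall n, nmul n rieger_unit = (Z.of_nat n, zero)).
  { induction n as [|n IH]; [easy|].
    change (rieger_unit + nmul n rieger_unit = (Z.of_nat (S n), zero)).
    rewrite IH. unfold rieger_unit. rewrite rieger_addE, carry_0l, add0l.
    f_equal. lia. }
  intros [|p|p]; simpl; [easy| |].
  - rewrite N. f_equal. lia.
  - change (- nmul (Pos.to_nat p) rieger_unit = (Zneg p, zero)).
    rewrite N. simpl. rewrite carry_0l, opp0. f_equal. lia. }
rewrite E. destruct x as [l a]. rewrite rieger_addE, carryC, carry_0l, add0r.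
simpl. f_equal. lia.
Qed.

(** The indicator is the borrow of the subtraction. *)
Lemma rieger_sub (k l : Z) (a b : G) :
  mk k b - mk l a = mk (k - l - ind (below b a)) (b - a).
Proof.
simpl. f_equal. rewrite carry_opp.
rewrite (carryC b), carry_below_opp, oppK.
assert (N : - a <> zero <-> a <> zero).
{ split; intros H K; apply H; [rewrite K; apply opp0|].
  now rewrite <- (oppK a), K, opp0. }
rewrite (ind_iff N). lia.
Qed.

Lemma rieger_spos (x : rieger) : spos x <-> (0 <= fst x)%Z /\ x <> zero.
Proof.
split.
- intros H. split; [now apply spos_pos in H|now apply spos_neq].
- intros [H K]. now apply pos_neq_spos.
Qed.

Lemma sub_eq0 (x y : G) : x - y = zero <-> x = y.
Proof.
split; [|intros ->; apply addNr].
intros E. apply (@addI _ _ (- y)). now rewrite addC, E, addNl.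
Qed.

Lemma rieger_sub_spos (a b : G) : spos (mk 0 b - mk 0 a) <-> below a b.
Proof.
rewrite rieger_spos, rieger_sub. simpl. unfold ind.
destruct (excluded_middle_informative (below b a)) as [H|H].
- split; [lia|]. intros K. now apply below_asym in H.
- split.
  + intros [_ N]. destruct (below_total a b) as [K|[->|K]]; try easy.
    exfalso. apply N. now rewrite addNr.
  + intros K. split; [lia|]. intros E. injection E as E.
    apply sub_eq0 in E as ->. now apply below_irrefl in K.
Qed.

Lemma rieger_unit_spos : spos rieger_unit.
Proof. apply rieger_spos. split; [simpl; lia|]. intros E. discriminate E. Qed.

(** The interval from [zero] to the unit, the unit excluded, is a copy of [G]; a witness found in it
    upstairs is thus the standard lift of an element of [G]. *)
Lemma rieger_box (x : rieger) :
  pos x -> spos (rieger_unit - x) -> x = mk 0 (snd x).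
Proof.
destruct x as [k a]. unfold rieger_unit. rewrite rieger_spos, rieger_sub. cbn [fst snd].
intros H [K N]. change (0 <= k)%Z in H. f_equal.
unfold ind in K. destruct (excluded_middle_informative (below zero a)) as [J|J]; [lia|].
rewrite below_0l in J. apply NNPP in J as ->.
destruct (Z.eq_dec k 1) as [->|]; [|lia].
exfalso. apply N. rewrite addNr, ind_false by apply below_irrefl.
reflexivity.
Qed.

Lemma rieger_box_spos (a : G) : spos (rieger_unit - mk 0 a).
Proof.
unfold rieger_unit. rewrite rieger_spos, rieger_sub. cbn [fst snd].
split; [unfold ind; destruct (excluded_middle_informative _); lia|].
intros E. injection E as E1 E2. rewrite add0l in E2.
assert (E : a = zero) by now rewrite <- (oppK a), E2, opp0.
subst a. rewrite ind_false in E1 by apply below_irrefl. easy.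
Qed.

Lemma rieger_unwinding : unwinding rieger_unit (snd : rieger -> G).
Proof.
split.
- exact rieger_unit_spos.
- intros [k a]. exists (k + 1)%Z.
  assert (E : zmul (k + 1) rieger_unit = (k + 1, zero)%Z).
  { pose proof (rieger_add_unit zero (k + 1)) as E. now rewrite add0l in E. }
  rewrite E, rieger_sub. simpl. unfold ind. destruct (excluded_middle_informative _); lia.
- easy.
- intros a. now exists (mk 0 a).
- intros [k a] [l b]. cbn [snd]. split.
  + intros ->. exists (k - l)%Z. rewrite rieger_add_unit. cbn [fst snd]. f_equal. lia.
  + intros [m E]. rewrite rieger_add_unit in E. now injection E.
- intros a b c. split.
  + intros H.
    apply (cyc_translate _ _ _ (- a)) in H. rewrite addNr in H.
    pose proof (cyc_distinct H) as (N & _ & _).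
    (* Once [a] is translated to [zero], the other two points lift in increasing order into the
       fundamental domain. *)
    exists (mk 0 a), (mk 0 a + mk 0 (b - a)), (mk 0 a + mk 0 (c - a)).
    apply below_cyc in H; [|congruence].
    repeat split.
    * simpl. abel.
    * simpl. abel.
    * assert (K : spos (mk 0 (b - a) - mk 0 zero)).
      { apply rieger_sub_spos, below_0l. congruence. }
      apply (spos_eq K). change (mk 0 zero) with (zero : rieger). abel.
    * apply rieger_sub_spos in H. apply (spos_eq H). abel.
    * apply (spos_eq (@rieger_box_spos (c - a))). abel.
  + intros (x & y & t & <- & <- & <- & H1 & H2 & H3).
    assert (B : forall u, spos (u - x) -> spos (x + rieger_unit - u) ->
      u - x = mk 0 (snd u - snd x)).
    { intros u K1 K2. rewrite (@rieger_box (u - x)); [easy|now apply spos_pos|].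
      apply (spos_eq K2). abel. }
    assert (Ey : y - x = mk 0 (snd y - snd x)).
    { apply B; [easy|]. refine (spos_eq (spos_add H2 (spos_pos H3)) _). abel. }
    assert (Et : t - x = mk 0 (snd t - snd x)).
    { apply B; [|easy]. refine (spos_eq (spos_add H1 (spos_pos H2)) _). abel. }
    apply (cyc_translate _ _ _ (- snd x)). rewrite addNr.
    apply below_cyc3.
    * apply rieger_sub_spos. rewrite <- Ey. apply (spos_eq H1).
      change (mk 0 zero) with (zero : rieger). abel.
    * apply rieger_sub_spos. rewrite <- Ey, <- Et. apply (spos_eq H2). abel.
Qed.

End Rieger.

(** An embedding preserves and reflects [below], hence preserves the carry, so the turns can be left
    unchanged. *)
Lemma rieger_map (G H : structure) (HG : abelian_cog G) (HH : abelian_cog H) (f : G -> H) :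
  embedding f ->
  omono (fun x : rieger HG => (fst x, f (snd x)) : rieger HH).
Proof.
intros (I & Z & A & _ & C).
split; [|easy].
intros [k a] [l b]. simpl. rewrite A. f_equal. f_equal.
apply ind_iff. unfold below. rewrite C, Z, !A.
assert (E : forall x, x = zero <-> f x = zero).
{ intros x. rewrite <- Z. split; [now intros ->|apply I]. }
now rewrite (E (add a b)), (E a), A.
Qed.

(** * Quotients *)

Section Quotient.

Variables (X : Type) (E : X -> X -> Prop).
Hypotheses (Erefl : forall x, E x x) (Esym : forall x y, E x y -> E y x)
  (Etrans : forall x y t, E x y -> E y t -> E x t).

(** Equivalent points have equal predicates [E x] by extensionality, so [epsilon] picks the same
    representative for them, and classes can be compared by Leibniz equality. *)
Definition canon (x : X) : X := epsilon (inhabits x) (E x).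

Lemma canon_rel (x : X) : E x (canon x).
Proof. exact (epsilon_spec (inhabits x) (E x) (ex_intro _ x (Erefl x))). Qed.

Lemma canon_eq (x y : X) : E x y -> canon x = canon y.
Proof.
intros H. unfold canon.
assert (K : E x = E y).
{ apply functional_extensionality. intros t. apply propositional_extensionality.
  split; intros; [apply (Etrans (Esym H))|apply (Etrans H)]; easy. }
rewrite K. f_equal. apply proof_irrelevance.
Qed.

Definition quot : Type := {x : X | canon x = x}.

Definition cls (x : X) : quot := exist _ (canon x) (canon_eq (Esym (canon_rel x))).

Definition repr (a : quot) : X := proj1_sig a.

Lemma cls_eq (x y : X) : cls x = cls y <-> E x y.
Proof.
split.
- intros H. injection H as H.
  apply (Etrans (canon_rel x)). rewrite H. apply Esym, canon_rel.
- intros H. unfold cls. apply subset_eq_compat. now apply canon_eq.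
Qed.

Lemma cls_repr (a : quot) : cls (repr a) = a.
Proof. destruct a as [x H]. unfold cls. now apply subset_eq_compat. Qed.

Lemma repr_cls (x : X) : E (repr (cls x)) x.
Proof. apply Esym, canon_rel. Qed.

Variables (x0 : X) (xadd : X -> X -> X) (xopp : X -> X) (R : X -> X -> X -> Prop).
Hypotheses
  (addE : forall x x' y y', E x x' -> E y y' -> E (xadd x y) (xadd x' y'))
  (oppE : forall x x', E x x' -> E (xopp x) (xopp x'))
  (RE : forall x x' y y' t t', E x x' -> E y y' -> E t t' -> R x y t -> R x' y' t')
  (xaddA : forall x y t, E (xadd x (xadd y t)) (xadd (xadd x y) t))
  (xaddC : forall x y, E (xadd x y) (xadd y x))
  (xadd0 : forall x, E (xadd x0 x) x)
  (xaddN : forall x, E (xadd x (xopp x)) x0).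

Definition quot_structure : structure :=
  {| carrier := quot;
     zero := cls x0;
     add := fun a b => cls (xadd (repr a) (repr b));
     opp := fun a => cls (xopp (repr a));
     cyc := fun a b c => R (repr a) (repr b) (repr c) |}.

Lemma quot_add (x y : X) : add (cls x : quot_structure) (cls y) = cls (xadd x y).
Proof. apply cls_eq, addE; apply repr_cls. Qed.

Lemma quot_opp (x : X) : opp (cls x : quot_structure) = cls (xopp x).
Proof. apply cls_eq, oppE, repr_cls. Qed.

Lemma quot_cyc (x y t : X) : cyc (cls x : quot_structure) (cls y) (cls t) <-> R x y t.
Proof.
split; apply RE; try apply repr_cls; apply Esym, repr_cls.
Qed.

Lemma quot_abelian : abelian quot_structure.
Proof.
assert (C : is_commutative quot_structure).
{ intros a b. rewrite <- (cls_repr a), <- (cls_repr b), !quot_add. now apply cls_eq. }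
assert (Z : forall a : quot_structure, add zero a = a).
{ intros a. rewrite <- (cls_repr a). simpl zero. rewrite quot_add. now apply cls_eq. }
assert (N : forall a : quot_structure, add a (opp a) = zero).
{ intros a. rewrite <- (cls_repr a), quot_opp, quot_add. now apply cls_eq. }
split; [split; [|split; [|split; [|split]]]|easy]; intros a; auto.
- intros b c. rewrite <- (cls_repr a), <- (cls_repr b), <- (cls_repr c), !quot_add.
  now apply cls_eq.
- now rewrite C.
- now rewrite C.
Qed.

Variable xpos : X -> Prop.
Hypotheses
  (posE : forall x y, E x y -> xpos x -> xpos y)
  (xpos_add : forall x y, xpos x -> xpos y -> xpos (xadd x y))
  (xpos_total : forall x, xpos x \/ xpos (xopp x))
  (xpos_anti : forall x, xpos x -> xpos (xopp x) -> E x x0).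

Lemma quot_pos (x : X) : xpos (repr (cls x)) <-> xpos x.
Proof. split; apply posE; [|apply Esym]; apply repr_cls. Qed.

Definition quot_ordgroup : ordgroup.
Proof.
refine {| og := quot_structure; og_abelian := quot_abelian;
          pos := fun a => xpos (repr a) |}.
- intros a b. rewrite <- (cls_repr a), <- (cls_repr b), quot_add, !quot_pos.
  apply xpos_add.
- intros a. rewrite <- (cls_repr a), quot_opp, !quot_pos. apply xpos_total.
- intros a. rewrite <- (cls_repr a), quot_opp, !quot_pos. intros H K.
  apply cls_eq. now apply xpos_anti.
Defined.

End Quotient.

(** * Winding an ordered group around a circle *)

Section Winding.

Variables (L : ordgroup) (z : L).
Open Scope grp_scope.

Let E (x y : L) : Prop := exists k : Z, x = y + zmul k z.

(** Saturated under [E] by construction, so that it descends to the quotient. *)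
Let R (a b c : L) : Prop := exists x y t, E x a /\ E y b /\ E t c /\
  spos (y - x) /\ spos (t - y) /\ spos (x + z - t).

Lemma winding : spos z -> cofinal z ->
  exists (G : structure) (p : L -> G), abelian G /\ unwinding z p.
Proof.
intros Hz Hc.
assert (Er : forall x, E x x) by (intros x; exists 0%Z; abel).
assert (Es : forall x y, E x y -> E y x).
{ intros x y [k ->]. exists (- k)%Z. abel. }
assert (Et : forall x y t, E x y -> E y t -> E x t).
{ intros x y t [k ->] [l ->]. exists (k + l)%Z. abel. }
assert (Ea : forall x x' y y', E x x' -> E y y' -> E (x + y) (x' + y')).
{ intros x x' y y' [k ->] [l ->]. exists (k + l)%Z. abel. }
assert (Eo : forall x x', E x x' -> E (- x) (- x')).
{ intros x x' [k ->]. exists (- k)%Z. abel. }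
assert (ER : forall x x' y y' t t', E x x' -> E y y' -> E t t' -> R x y t -> R x' y' t').
{ intros x x' y y' t t' H1 H2 H3 (a & b & c & K1 & K2 & K3 & K).
  exists a, b, c. split; [|split; [|split]]; eauto. }
assert (Ee : forall x y, x = y -> E x y) by (intros x y ->; apply Er).
pose (G := quot_structure Er Es Et zero add opp R).
exists G, (cls Er Es Et).
split.
{ unfold G. apply quot_abelian; try easy; intros; apply Ee; abel. }
split; try easy.
- intros x y. symmetry. now apply quot_add.
- intros a. exists (repr a). apply cls_repr.
- intros x y. apply cls_eq.
- intros a b c. rewrite <- (cls_repr Er Es Et a), <- (cls_repr Er Es Et b),
    <- (cls_repr Er Es Et c).
  unfold G. rewrite quot_cyc by easy.
  split; intros (x & y & t & H1 & H2 & H3 & H); exists x, y, t.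
  + repeat split; try apply cls_eq; easy.
  + apply cls_eq in H1, H2, H3. easy.
Qed.

End Winding.

(** * Divisible hulls of ordered groups *)

Section Hull.

Variable L : ordgroup.
Open Scope grp_scope.

(** The pair [(x, n)] stands for [x / n]. *)
Let frac : Type := (L * positive)%type.

Let E (u v : frac) : Prop := zmul (Zpos (snd v)) (fst u) = zmul (Zpos (snd u)) (fst v).

(** The denominators are positive, so a fraction has the sign of its numerator. The last clause
    expresses minimality and is what [omono_extension] asks for. *)
Lemma divisible_hull : exists (H : ordgroup) (i : L -> H),
  omono i /\ odivisible H /\
  forall u, exists (n : Z) (x : L), (0 < n)%Z /\ zmul n u = i x.
Proof.
assert (Er : forall x, E x x) by (intros [x p]; reflexivity).
assert (Es : forall x y, E x y -> E y x).
{ intros [x p] [y q] H. unfold E in *. now symmetry. }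
assert (Et : forall x y t, E x y -> E y t -> E x t).
{ intros [x p] [y q] [t r] H K. unfold E in *. cbn [fst snd] in *.
  (* The middle denominator can be cancelled because an ordered group is torsion-free. *)
  apply (@zmul_inj _ (Zpos q)); [easy|].
  transitivity (zmul (Zpos r) (zmul (Zpos q) x)); [abel|].
  rewrite H. transitivity (zmul (Zpos p) (zmul (Zpos r) y)); [abel|].
  rewrite K. abel. }
pose (fadd := fun u v : frac =>
  (zmul (Zpos (snd v)) (fst u) + zmul (Zpos (snd u)) (fst v), Pos.mul (snd u) (snd v))).
pose (fopp := fun u : frac => (- fst u, snd u)).
assert (Ea : forall x x' y y', E x x' -> E y y' -> E (fadd x y) (fadd x' y')).
{ intros [x p] [x' p'] [y q] [y' q'] H K. unfold E, fadd in *. cbn [fst snd] in *.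
  rewrite !Pos2Z.inj_mul.
  transitivity (zmul (Zpos q * Zpos q') (zmul (Zpos p') x) +
    zmul (Zpos p * Zpos p') (zmul (Zpos q') y)); [abel|].
  rewrite H, K. abel. }
assert (Eo : forall x x', E x x' -> E (fopp x) (fopp x')).
{ intros [x p] [y q] H. unfold E, fopp in *. cbn [fst snd] in *.
  now rewrite !zmul_opp_r, H. }
assert (A : forall x y t, E (fadd x (fadd y t)) (fadd (fadd x y) t)).
{ intros [x p] [y q] [t r]. unfold E, fadd. cbn [fst snd].
  rewrite !Pos2Z.inj_mul. abel. }
assert (C : forall x y, E (fadd x y) (fadd y x)).
{ intros [x p] [y q]. unfold E, fadd. cbn [fst snd]. rewrite !Pos2Z.inj_mul. abel. }
assert (Z : forall x, E (fadd (zero, 1%positive) x) x).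
{ intros [x p]. unfold E, fadd. cbn [fst snd]. rewrite !Pos2Z.inj_mul. abel. }
assert (N : forall x, E (fadd x (fopp x)) (zero, 1%positive)).
{ intros [x p]. unfold E, fadd, fopp. cbn [fst snd]. rewrite !Pos2Z.inj_mul. abel. }
assert (Pa : forall x y : frac, pos (fst x) -> pos (fst y) -> pos (fst (fadd x y))).
{ intros [x p] [y q] H K. apply pos_add; now apply pos_zmul. }
assert (PE : forall x y : frac, E x y -> pos (fst x) -> pos (fst y)).
{ intros [x p] [y q] H K. apply (@pos_zmul_inv _ (Zpos p)); [easy|].
  unfold E in H. cbn [fst snd] in *. rewrite <- H. now apply pos_zmul. }
assert (Pt : forall x : frac, pos (fst x) \/ pos (fst (fopp x)))
  by (intros [x p]; apply pos_total).
assert (Pn : forall x : frac, pos (fst x) -> pos (fst (fopp x)) -> E x (zero, 1%positive)).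
{ intros [x p] H K. unfold E. cbn [fst snd] in *. rewrite (pos_anti H K). abel. }
pose (H := quot_ordgroup Er Es Et (fun _ _ _ => False) Ea Eo A C Z N PE Pa Pt Pn).
pose (q := cls Er Es Et : frac -> H).
assert (qadd : forall u v, q u + q v = q (fadd u v)).
{ intros u v. exact (quot_add Er Es Et (zero, 1%positive) fopp (fun _ _ _ => False) Ea u v). }
assert (qmul : forall k (x : L) p, (0 < k)%Z -> zmul k (q (x, p)) = q (zmul k x, p)).
{ intros k x p Hk. rewrite <- (Z2Nat.id k) by lia. rewrite !zmul_of_nat.
  assert (Q0 : forall r, q (zero, r) = zero).
  { intros r. apply (cls_eq Er Es Et). unfold E. cbn [fst snd]. abel. }
  induction (Z.to_nat k) as [|n IH]; [exact (eq_sym (Q0 p))|].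
  change (q (x, p) + nmul n (q (x, p)) = q (x + nmul n x, p)). rewrite IH, qadd.
  apply (cls_eq Er Es Et). unfold E, fadd. cbn [fst snd].
  rewrite !Pos2Z.inj_mul. abel. }
exists H, (fun x => q (x, 1%positive)). split; [split|split].
- intros x y. rewrite qadd. apply (cls_eq Er Es Et). unfold E, fadd. cbn [fst snd].
  rewrite !Pos2Z.inj_mul. abel.
- intros x. symmetry. apply (quot_pos Er Es Et PE).
- intros n u Hn. rewrite <- (cls_repr Er Es Et u). destruct (repr u) as [x p].
  exists (q (x, (Z.to_pos n * p)%positive)). rewrite qmul by easy.
  apply (cls_eq Er Es Et). unfold E. cbn [fst snd].
  rewrite Pos2Z.inj_mul, Z2Pos.id by easy. abel.
- intros u. rewrite <- (cls_repr Er Es Et u). destruct (repr u) as [x p].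
  exists (Zpos p), x. split; [easy|].
  change (zmul (Zpos p) (q (x, p)) = q (x, 1%positive)). rewrite qmul by easy.
  apply (cls_eq Er Es Et). unfold E. cbn [fst snd]. abel.
Qed.

End Hull.

(** If [n u = i x], the image [v] of [u] has to satisfy [n v = f x]. Divisibility of [K] provides
    such a [v], torsion-freeness makes it independent of [n] and [x], and positive multiples do not
    change signs. *)
Lemma omono_extension (L H K : ordgroup) (i : L -> H) (f : L -> K) :
  omono i -> omono f -> odivisible K ->
  (forall u, exists (n : Z) (x : L), (0 < n)%Z /\ zmul n u = i x) ->
  exists g : H -> K, omono g /\ forall x, g (i x) = f x.
Proof.
intros Hi Hf DK S.
pose proof (proj1 Hi) as Ai. pose proof (proj1 Hf) as Af.
pose (R := fun u v => exists (n : Z) (x : L), (0 < n)%Z /\ zmul n u = i x /\ zmul n v = f x).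
assert (RT : forall u, exists v, R u v).
{ intros u. destruct (S u) as (n & x & Hn & E). destruct (DK n (f x) Hn) as [v Hv].
  now exists v, n, x. }
assert (RU : forall u v v', R u v -> R u v' -> v = v').
{ intros u v v' (n & x & Hn & E & F) (m & y & Hm & E' & F').
  apply (@zmul_inj _ (n * m)); [lia|].
  transitivity (zmul m (zmul n v)); [abel|].
  transitivity (zmul n (zmul m v')); [|abel].
  rewrite F, F', <- !(additive_zmul Af). f_equal. apply (omono_inj Hi).
  rewrite !(additive_zmul Ai), <- E, <- E'. abel. }
pose (g := fun u => proj1_sig (constructive_indefinite_description _ (RT u))).
assert (Rg : forall u, R u (g u)) by (intros u; apply proj2_sig).
exists g. split; [split|].
- intros u v. apply (@RU (add u v)); [easy|].
  destruct (Rg u) as (n & x & Hn & E & F), (Rg v) as (m & y & Hm & E' & F').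
  exists (n * m)%Z, (add (zmul m x) (zmul n y)). split; [lia|].
  rewrite Ai, Af, !(additive_zmul Ai), !(additive_zmul Af), <- E, <- E', <- F, <- F'.
  split; abel.
- intros u. destruct (Rg u) as (n & x & Hn & E & F).
  assert (P : forall (M : ordgroup) (w : M), pos w <-> pos (zmul n w)).
  { intros M w. split; [apply pos_zmul; lia|now apply pos_zmul_inv]. }
  rewrite (P _ u), (P _ (g u)), E, F, <- (proj2 Hi). apply Hf.
- intros x. apply (@RU (i x)); [easy|]. exists 1%Z, x. now rewrite !zmul_1.
Qed.

(** * Amalgamation of ordered groups *)

Section Cones.

Variable W : structure.
Context {AW : abelian W}.
Open Scope grp_scope.

(** In a cone [P] maximal with this property, if neither [x] nor [- x] lies in [P] then
    some positive multiples of both do, so [C] contains a multiple of [x]. *)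
Lemma total_cone (C : W -> Prop) :
  C zero -> (forall x y, C x -> C y -> C (x + y)) ->
  (forall n x, (0 < n)%Z -> C (zmul n x) -> C x) ->
  exists P : W -> Prop,
    (forall x, C x -> P x) /\ (forall x y, P x -> P y -> P (x + y)) /\
    (forall x, P x \/ P (- x)) /\ (forall x, P x -> P (- x) -> C x).
Proof.
intros C0 CA CI.
(* The chains in Zorn's lemma include the empty one, whose union is empty. Stating the conditions
   for [C x \/ Q x] makes this union good as well. *)
pose (good := fun Q : classical_sets.set W =>
  (forall x y, C x \/ Q x -> C y \/ Q y -> C (x + y) \/ Q (x + y)) /\
  (forall x, C x \/ Q x -> C (- x) \/ Q (- x) -> C x)).
destruct (@classical_sets.Zorn_bigcup W good) as (Q & [QA QI] & M).
{ intros F HF T.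
  assert (U : forall x, (exists Q, F Q /\ Q x) <->
    classical_sets.bigcup F (fun X => X) x).
  { intros x. split; [intros (Q & H & K); now exists Q|intros [Q H K]; now exists Q]. }
  assert (J : forall x y,
    C x \/ classical_sets.bigcup F (fun X => X) x ->
    C y \/ classical_sets.bigcup F (fun X => X) y ->
    (C x /\ C y) \/ exists Q, F Q /\ (C x \/ Q x) /\ (C y \/ Q y)).
  { intros x y. rewrite <- !U.
    intros [H|(Q & H & H')] [K|(Q' & K & K')].
    - now left.
    - right. exists Q'. tauto.
    - right. exists Q. tauto.
    - right. destruct (T Q Q' H K) as [I|I].
      + exists Q'. auto.
      + exists Q. auto. }
  split.
  - intros x y Hx Hy. destruct (J x y Hx Hy) as [[H K]|(Q & H & H1 & H2)].
    + left. now apply CA.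
    + destruct (proj1 (HF Q H) x y H1 H2); [tauto|]. right. apply U. now exists Q.
  - intros x Hx Hy. destruct (J x (- x) Hx Hy) as [[H K]|(Q & H & H1 & H2)]; [easy|].
    now apply (HF Q H). }
pose (P := fun x => C x \/ Q x).
assert (PC : forall x, C x -> P x) by (now left).
assert (PA : forall x y, P x -> P y -> P (x + y)) by exact QA.
assert (PI : forall x, P x -> P (- x) -> C x) by exact QI.
assert (PM : forall n x, (0 <= n)%Z -> P x -> P (zmul n x)).
{ intros n x Hn Hx. rewrite <- (Z2Nat.id n Hn), zmul_of_nat.
  induction (Z.to_nat n) as [|m IH]; simpl; [now apply PC|now apply PA]. }
assert (A : forall x, ~ P x -> exists k, (0 < k)%Z /\ P (- zmul k x)).
{ intros x Hx. apply NNPP. intros NK.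
  (* The cone generated by [P] and [x]. It properly extends [Q], and it is good unless [P] contains
     the opposite of a positive multiple of [x]. *)
  pose (Q' := fun y => exists n p, (0 <= n)%Z /\ P p /\ y = p + zmul n x).
  assert (CQ : forall y, C y \/ Q' y <-> Q' y).
  { intros y. split; [|tauto]. intros [H|H]; [|easy].
    exists 0%Z, y. split; [lia|]. split; [now apply PC|abel]. }
  apply (M Q').
  - split.
    + intros y Hy. exists 0%Z, y. split; [lia|]. split; [now right|abel].
    + intros E. apply Hx. right.
      assert (Q'x : Q' x).
      { exists 1%Z, zero. split; [lia|]. split; [now apply PC|abel]. }
      now apply E.
  - split.
    + intros y t. rewrite !CQ. intros (n & p & Hn & Hp & ->) (m & q & Hm & Hq & ->).
      exists (n + m)%Z, (p + q). split; [lia|]. split; [now apply PA|abel].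
    + intros y. rewrite !CQ. intros (n & p & Hn & Hp & E) (m & q & Hm & Hq & F).
      destruct (Z.eq_dec (n + m) 0) as [E0|E0].
      * assert (n = 0%Z) as -> by lia. assert (m = 0%Z) as -> by lia.
        apply PI.
        -- rewrite E. replace (p + zmul 0 x) with p by abel. easy.
        -- rewrite F. replace (q + zmul 0 x) with q by abel. easy.
      * exfalso. apply NK. exists (n + m)%Z. split; [lia|].
        replace (- zmul (n + m) x) with (p + q); [now apply PA|].
        transitivity ((p + zmul n x) + (q + zmul m x) - zmul (n + m) x); [abel|].
        rewrite <- E, <- F. abel. }
exists P. split; [easy|split; [easy|split; [|easy]]].
intros x. apply NNPP. intros N. apply not_or_and in N as [N1 N2].
destruct (A x N1) as (k & Hk & H), (A _ N2) as (l & Hl & K).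
apply N1, PC. apply (CI (k * l)%Z); [lia|]. apply PI.
- replace (zmul (k * l) x) with (zmul k (- zmul l (- x))) by abel.
  apply PM; [lia|easy].
- replace (- zmul (k * l) x) with (zmul l (- zmul k x)) by abel.
  apply PM; [lia|easy].
Qed.

End Cones.

Section Amalgam.

Variables (L0 L1 L2 : ordgroup) (f1 : L0 -> L1) (f2 : L0 -> L2).
Hypotheses (H1 : omono f1) (H2 : omono f2) (D0 : odivisible L0).
Open Scope grp_scope.

Let W : structure :=
  {| carrier := L1 * L2;
     zero := (zero, zero);
     add := fun u v => (fst u + fst v, snd u + snd v);
     opp := fun u => (- fst u, - snd u);
     cyc := fun _ _ _ => False |}.

(** The cone generated by the nonnegative elements of both factors and the pairs [(f1 a, - f2 a)],
    which the pushout identifies with [zero]. *)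
Let C (u : W) : Prop := exists a : L0, pos (fst u - f1 a) /\ pos (snd u + f2 a).

(** [N] is the product modulo the elements that lie in the total cone together with their opposites.
    By [total_cone] such elements already lie in [C], which keeps the enlarged cone from changing
    signs inside [L1] and [L2]. *)
Lemma amalgam : exists (N : ordgroup) (g1 : L1 -> N) (g2 : L2 -> N),
  omono g1 /\ omono g2 /\ (forall a, g1 (f1 a) = g2 (f2 a)) /\
  forall w, exists x y, w = g1 x + g2 y.
Proof.
pose proof (proj1 H1) as A1. pose proof (proj1 H2) as A2.
assert (AW : abelian W).
{ split; [split; [|split; [|split; [|split]]]|].
  - intros [] [] []. simpl. now rewrite !addA.
  - intros []. simpl. now rewrite !add0l.
  - intros []. simpl. now rewrite !add0r.
  - intros []. simpl. now rewrite !addNl.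
  - intros []. simpl. now rewrite !addNr.
  - intros [] []. simpl. f_equal; apply addC. }
assert (Wmul : forall k (u : W), zmul k u = (zmul k (fst u), zmul k (snd u))).
{ intros k u.
  pose proof (additive_zmul (g := fst : W -> L1) (fun _ _ => eq_refl) k u) as F.
  pose proof (additive_zmul (g := snd : W -> L2) (fun _ _ => eq_refl) k u) as S.
  rewrite <- F, <- S. now destruct (zmul k u). }
destruct (@total_cone W AW C) as (P & PC & PA & PT & PI).
- exists zero. rewrite (additive_zero A1), (additive_zero A2). simpl. rewrite opp0, !add0l.
  split; apply pos_zero.
- intros [x y] [x' y'] [a [K1 K2]] [b [K3 K4]]. exists (a + b). rewrite A1, A2.
  simpl in *. split.
  + apply (pos_eq (pos_add K1 K3)). abel.
  + apply (pos_eq (pos_add K2 K4)). abel.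
- intros n [x y] Hn [a [K1 K2]]. rewrite Wmul in K1, K2. simpl in K1, K2.
  (* Divisibility of [L0] is used here: the separating element for [n u] has to be divided by [n] to
     separate for [u]. *)
  destruct (D0 a Hn) as [b <-]. exists b.
  rewrite (additive_zmul A1) in K1. rewrite (additive_zmul A2) in K2.
  simpl. split; apply (@pos_zmul_inv _ n); try easy.
  + apply (pos_eq K1). abel.
  + apply (pos_eq K2). abel.
- assert (P0 : P zero).
  { destruct (PT zero) as [H|H]; [easy|]. now rewrite opp0 in H. }
  pose (E := fun u v : W => P (u - v) /\ P (v - u)).
  assert (Er : forall x, E x x) by (intros x; split; now rewrite addNr).
  assert (Es : forall x y, E x y -> E y x) by (now intros x y []).
  assert (Pe : forall x y, P x -> x = y -> P y) by (now intros x y H <-).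
  assert (Et : forall x y t, E x y -> E y t -> E x t).
  { intros x y t [] []. split.
    - apply (Pe (x - y + (y - t))); [now apply PA|abel].
    - apply (Pe (t - y + (y - x))); [now apply PA|abel]. }
  assert (Ea : forall x x' y y', E x x' -> E y y' -> E (x + y) (x' + y')).
  { intros x x' y y' [] []. split.
    - apply (Pe (x - x' + (y - y'))); [now apply PA|abel].
    - apply (Pe (x' - x + (y' - y))); [now apply PA|abel]. }
  assert (Eo : forall x x', E x x' -> E (- x) (- x')).
  { intros x x' []. split.
    - apply (Pe (x' - x)); [easy|abel].
    - apply (Pe (x - x')); [easy|abel]. }
  assert (Ee : forall x y, x = y -> E x y) by (intros x y ->; apply Er).
  assert (PE : forall x y, E x y -> P x -> P y).
  { intros x y [] ?. apply (Pe (x + (y - x))); [now apply PA|abel]. }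
  assert (Pn : forall x, P x -> P (- x) -> E x zero).
  { intros x H K. split; [apply (Pe _ _ H)|apply (Pe _ _ K)]; abel. }
  pose (N := quot_ordgroup Er Es Et (fun _ _ _ => False) Ea Eo
    (fun x y t => Ee _ _ (addA x y t)) (fun x y => Ee _ _ (addC x y))
    (fun x => Ee _ _ (add0l x)) (fun x => Ee _ _ (addNr x)) PE PA PT Pn).
  pose (q := cls Er Es Et : W -> N).
  assert (qadd : forall u v, q u + q v = q (u + v)).
  { intros u v. exact (quot_add Er Es Et zero opp (fun _ _ _ => False) Ea u v). }
  assert (qpos : forall u, pos (q u) <-> P u) by exact (quot_pos Er Es Et PE).
  exists N, (fun x => q (x, zero)), (fun y => q (zero, y)).
  split; [split|split; [split|split]].
  + intros x y. rewrite qadd. simpl. now rewrite add0l.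
  + intros x. rewrite qpos. split.
    * intros H. apply PC. exists zero. rewrite (additive_zero A1), (additive_zero A2). simpl.
      rewrite opp0, !add0r. split; [easy|apply pos_zero].
    (* If [- x] is nonnegative, then [(x, zero)] and its opposite are both in [P], so [(x, zero)] is
       in [C]; this gives an [a] with [f2 a >= 0], hence [f1 a >= 0], and [x >= f1 a]. *)
    * intros H. destruct (pos_total x) as [K|K]; [easy|].
      destruct (@PI (x, zero)) as [a [K1 K2]]; [easy| |].
      { simpl. rewrite opp0. apply PC. exists zero. rewrite (additive_zero A1), (additive_zero A2).
        simpl. rewrite opp0, !add0r. split; [easy|apply pos_zero]. }
      simpl in K1, K2. rewrite add0l in K2. apply H2, H1 in K2.
      apply (pos_eq (pos_add K1 K2)). abel.
  + intros x y. rewrite qadd. simpl. now rewrite add0l.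
  + intros y. rewrite qpos. split.
    * intros H. apply PC. exists zero. rewrite (additive_zero A1), (additive_zero A2). simpl.
      rewrite opp0, !add0r. split; [apply pos_zero|easy].
    * intros H. destruct (pos_total y) as [K|K]; [easy|].
      destruct (@PI (zero, y)) as [a [K1 K2]]; [easy| |].
      { simpl. rewrite opp0. apply PC. exists zero. rewrite (additive_zero A1), (additive_zero A2).
        simpl. rewrite opp0, !add0r. split; [apply pos_zero|easy]. }
      simpl in K1, K2. rewrite add0l, <- (additive_opp A1) in K1.
      apply H1, H2 in K1. rewrite (additive_opp A2) in K1.
      apply (pos_eq (pos_add K1 K2)). abel.
  + intros a. apply (cls_eq Er Es Et). split; apply PC.
    * exists a. simpl. rewrite opp0, add0l, add0r, addNr, addNl.
      split; apply pos_zero.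
    * exists (- a). rewrite (additive_opp A1), (additive_opp A2). simpl.
      rewrite opp0, add0l, add0r, !addNr. split; apply pos_zero.
  + intros w. rewrite <- (cls_repr Er Es Et w). destruct (repr w) as [x y].
    exists x, y. change (q (x, y) = q (x, zero) + q (zero, y)).
    rewrite qadd. simpl. now rewrite add0l, add0r.
Qed.

End Amalgam.

(** * The unit circle *)

Definition R_ordgroup : ordgroup.
Proof.
refine {| og := {| carrier := R; zero := 0%R; add := Rplus; opp := Ropp;
                   cyc := fun _ _ _ => False |};
          pos := fun x => (0 <= x)%R |}; simpl; intros; try lra.
split; [repeat split; simpl; intros; lra|intros x y; simpl; lra].
Defined.

Definition Z_ordgroup : ordgroup.
Proof.
refine {| og := {| carrier := Z; zero := 0%Z; add := Z.add; opp := Z.opp;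
                   cyc := fun _ _ _ => False |};
          pos := fun x => (0 <= x)%Z |}; simpl; intros; try lia.
split; [repeat split; simpl; intros; lia|intros x y; simpl; lia].
Defined.

Lemma R_zmul (k : Z) (x : R_ordgroup) : zmul k x = (IZR k * x)%R.
Proof.
assert (N : forall n, nmul n x = (INR n * x)%R).
{ induction n as [|n IH]; [simpl; lra|].
  change (x + nmul n x = INR (S n) * x)%R. rewrite IH, S_INR. lra. }
destruct (Z_as_diff k) as (a & b & ->).
rewrite zmul_diff, !N, minus_IZR, <- !INR_IZR_INZ. simpl. lra.
Qed.

Lemma Cmod_expi (t : R) : Cmod (expi t) = 1%R.
Proof.
unfold Cmod, expi. simpl fst; simpl snd.
replace (cos t ^ 2 + sin t ^ 2)%R with 1%R; [apply sqrt_1|].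
pose proof (sin2_cos2 t). unfold Rsqr in *. simpl. lra.
Qed.

Definition wind (t : R_ordgroup) : circle := exist _ (expi t) (Cmod_expi t).

Lemma expi_add (a b : R) : expi (a + b) = (expi a * expi b)%C.
Proof. unfold expi, Cmult. simpl. now rewrite cos_plus, sin_plus, (Rplus_comm (_ * sin b)). Qed.

Lemma expi_surj (x : C) : Cmod x = 1%R -> exists t, x = expi t.
Proof.
destruct x as [a b]. unfold Cmod. simpl fst; simpl snd. intros H.
assert (E : (a * a + b * b = 1)%R).
{ apply (f_equal (fun r => r * r)%R) in H. rewrite sqrt_sqrt in H; [lra|nra]. }
assert (B : (-1 <= a <= 1)%R) by nra.
destruct (Rle_lt_dec 0 b) as [Hb|Hb].
- exists (acos a). unfold expi. rewrite cos_acos, sin_acos by easy. f_equal.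
  unfold Rsqr. replace (1 - a * a)%R with (b * b)%R by lra.
  symmetry. now apply sqrt_square.
- exists (- acos a)%R. unfold expi. rewrite cos_neg, sin_neg, cos_acos, sin_acos by easy.
  f_equal. unfold Rsqr. replace (1 - a * a)%R with ((- b) * (- b))%R by lra.
  rewrite sqrt_square by lra. lra.
Qed.

Lemma expi_period (t : R) (k : Z) : expi (t + IZR k * (2 * PI)) = expi t.
Proof.
assert (N : forall n t, expi (t + INR n * (2 * PI)) = expi t).
{ intros n u. replace (u + INR n * (2 * PI))%R with (u + 2 * INR n * PI)%R by lra.
  unfold expi. now rewrite cos_period, sin_period. }
destruct (Z_as_diff k) as (a & b & ->).
rewrite minus_IZR, <- !INR_IZR_INZ.
rewrite <- (N b), <- (N a t). f_equal. lra.
Qed.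

Lemma expi_eq1 (t : R) : expi t = expi 0 -> exists k, t = (IZR k * (2 * PI))%R.
Proof.
unfold expi. rewrite cos_0, sin_0. intros H. injection H as Hc Hs.
apply sin_eq_0_0 in Hs as [k ->].
destruct (Z.Even_or_Odd k) as [[m ->]|[m ->]].
- exists m. rewrite mult_IZR. lra.
- exfalso. rewrite plus_IZR, mult_IZR in Hc.
  replace ((2 * IZR m + 1) * PI)%R with (PI + IZR m * (2 * PI))%R in Hc by lra.
  assert (E := f_equal fst (expi_period PI m)). unfold expi in E. simpl in E.
  rewrite E, cos_PI in Hc. lra.
Qed.

Lemma circle_unwinding : unwinding ((2 * PI)%R : R_ordgroup) wind.
Proof.
assert (Hpi := PI_RGT_0).
assert (Sp : forall x : R_ordgroup, spos x <-> (0 < x)%R).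
{ intros x. unfold spos. simpl. split; lra. }
assert (HK : forall x y, wind x = wind y <-> exists k, x = (y + IZR k * (2 * PI))%R).
{ intros x y. split.
  - intros H. injection H as Hc Hs.
    destruct (@expi_eq1 (x - y)) as [k Hk].
    + unfold expi. rewrite cos_minus, sin_minus, cos_0, sin_0, Hc, Hs.
      pose proof (sin2_cos2 y). unfold Rsqr in *. f_equal; lra.
    + exists k. rewrite <- Hk. lra.
  - intros [k ->]. apply circle_eq. apply expi_period. }
assert (Fl : forall x : R, exists k, (0 <= x - IZR k * (2 * PI) < 2 * PI)%R).
{ intros x. destruct (archimed (x / (2 * PI))) as [A B].
  exists (up (x / (2 * PI)) - 1)%Z. rewrite minus_IZR.
  apply (Rmult_lt_compat_r (2 * PI)) in A; [|lra].
  apply (Rmult_le_compat_r (2 * PI)) in B; [|lra].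
  replace (x / (2 * PI) * (2 * PI))%R with x in A by (field; lra).
  rewrite Rmult_minus_distr_r in B.
  replace (x / (2 * PI) * (2 * PI))%R with x in B by (field; lra). lra. }
split.
- apply Sp. lra.
- intros x. destruct (Fl x) as [k Hk]. exists (k + 1)%Z.
  rewrite R_zmul, plus_IZR. simpl. lra.
- intros x y. apply circle_eq. apply expi_add.
- intros [x Hx]. destruct (expi_surj Hx) as [t ->]. exists t. now apply circle_eq.
- intros x y. rewrite HK. split; intros [k ->]; exists k; now rewrite R_zmul.
- intros a b c. split.
  + intros (x & y & t & Hx & Hy & Ht & Ea & Eb & Ec & H).
    (* Those of the angles [y] and [t] that precede [x] are raised by a full turn. *)
    assert (S : exists y' t', expi y' = expi y /\ expi t' = expi t /\
      (x < y')%R /\ (y' < t')%R /\ (t' < x + 2 * PI)%R).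
    { assert (P1 : forall u, expi (u + 2 * PI) = expi u).
      { intros u. rewrite <- (expi_period u 1). f_equal. lra. }
      destruct H as [H|[H|H]].
      - exists y, t. repeat split; lra.
      - exists (y + 2 * PI)%R, (t + 2 * PI)%R. rewrite !P1. repeat split; lra.
      - exists y, (t + 2 * PI)%R. rewrite !P1. repeat split; lra. }
    destruct S as (y' & t' & Ey & Et & K1 & K2 & K3).
    exists (x : R_ordgroup), (y' : R_ordgroup), (t' : R_ordgroup).
    split; [apply circle_eq; simpl; congruence|].
    split; [apply circle_eq; simpl; congruence|].
    split; [apply circle_eq; simpl; congruence|].
    rewrite !Sp. simpl. lra.
  + intros (x & y & t & <- & <- & <- & H1 & H2 & H3).
    rewrite Sp in H1, H2, H3. simpl in H1, H2, H3.
    destruct (Fl x) as [k Hk].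
    set (d := (IZR k * (2 * PI))%R) in *.
    (* Subtracting the turns [d] of [x] brings [u] into the first or second turn; in the latter case
       one more turn is removed, which rotates the triple. *)
    assert (Q : forall u, (x < u < x + 2 * PI)%R -> exists v, (0 <= v < 2 * PI)%R /\
      expi u = expi v /\ (v = u - d \/ v = u - d - 2 * PI)%R).
    { intros u Hu.
      assert (D1 : expi (u - d) = expi u).
      { rewrite <- (expi_period (u - d) k). f_equal. unfold d. lra. }
      assert (D2 : expi (u - d - 2 * PI) = expi u).
      { rewrite <- (expi_period _ (k + 1)). f_equal. rewrite plus_IZR. unfold d. lra. }
      destruct (Rlt_le_dec (u - d) (2 * PI)).
      - exists (u - d)%R. split; [lra|]. split; [easy|tauto].
      - exists (u - d - 2 * PI)%R. split; [lra|]. split; [easy|tauto]. }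
    destruct (Q y) as (v & Hv & Ev & Dv); [lra|].
    destruct (Q t) as (w & Hw & Ew & Dw); [lra|].
    exists (x - d)%R, v, w. split; [easy|]. split; [easy|]. split; [easy|].
    split. { simpl. rewrite <- (expi_period (x - d) k). f_equal. unfold d. lra. }
    split; [easy|]. split; [easy|].
    destruct Dv as [->| ->], Dw as [->| ->]; lra.
Qed.

Lemma circle_cog : abelian_cog circle.
Proof. exact (uw_cog circle_unwinding circle_group). Qed.

Lemma sig_eq (A : Type) (P : A -> Prop) (x y : {a : A | P a}) :
  proj1_sig x = proj1_sig y -> x = y.
Proof. apply eq_sig_hprop. intros. apply proof_irrelevance. Qed.

Lemma induced_cog (G : structure) (P : subgroup G) :
  abelian_cog G -> abelian_cog (induced P).
Proof.
intros [((A & Zl & Zr & Nl & Nr) & D & R & O & T) C].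
split; [split; [|split; [|split; [|split]]]|].
- split; [|split; [|split; [|split]]]; intros; apply sig_eq; simpl; auto.
- intros [a Ha] [b Hb] [c Hc] H. apply D in H. simpl in H.
  split; [|split]; intros E; injection E; tauto.
- intros [a Ha] [b Hb] [c Hc]. simpl. apply R.
- intros [g Hg]. destruct (O g) as (I & Tr & To).
  assert (N : forall (a b : induced P), a <> b -> proj1_sig a <> proj1_sig b).
  { intros a b H E. now apply H, sig_eq. }
  split; [|split].
  + intros a Ha. apply I. now apply (N a (exist _ g Hg)).
  + intros a b c Ha Hb Hc. apply Tr.
    * now apply (N a (exist _ g Hg)).
    * now apply (N b (exist _ g Hg)).
    * now apply (N c (exist _ g Hg)).
  + intros a b Ha Hb H. apply To.
    * now apply (N a (exist _ g Hg)).
    * now apply (N b (exist _ g Hg)).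
    * now apply N.
- intros a b c h h'. simpl. apply T.
- intros a b. apply sig_eq. apply C.
Qed.

Lemma induced_nmul (G : structure) (P : subgroup G) (n : nat) (x : induced P) :
  proj1_sig (nmul n x) = nmul n (proj1_sig x).
Proof. induction n as [|n IH]; simpl; [easy|now rewrite IH]. Qed.

Lemma torsion_circle_cog : abelian_cog torsion_circle.
Proof. exact (induced_cog _ circle_cog). Qed.

Lemma wind_nmul (n : nat) (t : R) : nmul n (wind t) = wind (INR n * t)%R.
Proof.
pose proof (cog_abelian circle_cog) as AC.
rewrite <- zmul_of_nat, <- (additive_zmul (uw_add circle_unwinding)), R_zmul.
now rewrite <- INR_IZR_INZ.
Qed.

Lemma torsion_circle_divisible : divisible torsion_circle.
Proof.
intros n [x Hx] Hn.
destruct (uw_surj circle_unwinding x) as [t <-].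
assert (Hn' : INR n <> 0%R) by now apply not_0_INR.
assert (E : nmul n (wind (t / INR n)%R) = wind t).
{ rewrite wind_nmul. f_equal. now field. }
assert (F : finite_order (wind (t / INR n)%R)).
{ destruct Hx as (m & Hm & Hx). exists (m * n)%nat. split; [lia|].
  rewrite (nmul_mult circle_group), E. exact Hx. }
exists (exist _ _ F). apply sig_eq. rewrite induced_nmul. exact E.
Qed.

(** In terms of the unwinding, [x] lifts to the [n]-th part of the unit. *)
Definition nth_root_of_unit (G : structure) (n : nat) (x : G) : Prop :=
  nmul n x = zero /\ x <> zero /\
  forall i, (2 <= i < n)%nat -> cyc zero x (nmul i x).

Lemma torsion_circle_roots (n : nat) :
  (2 <= n)%nat -> exists x : torsion_circle, nth_root_of_unit n x.
Proof.
intros Hn. assert (Hpi := PI_RGT_0).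
assert (Hn' : (2 <= INR n)%R) by (apply le_INR in Hn; simpl in Hn; lra).
set (t := (2 * PI / INR n)%R).
assert (Et : (INR n * t = 2 * PI)%R) by (unfold t; field; lra).
assert (W1 : wind (0 : R)%R = zero).
{ apply circle_eq. unfold wind, expi. simpl. now rewrite cos_0, sin_0. }
assert (W : wind (2 * PI)%R = zero).
{ rewrite <- W1. apply circle_eq. simpl. rewrite <- (expi_period 0 1). f_equal. lra. }
assert (F : finite_order (wind t)).
{ exists n. split; [lia|]. now rewrite wind_nmul, Et. }
assert (Pt : (0 < t)%R) by nra.
assert (C : forall i, (2 <= i < n)%nat -> cyc zero (wind t) (nmul i (wind t))).
{ intros i [Hi Hi']. rewrite wind_nmul, <- W1.
  apply le_INR in Hi. apply lt_INR in Hi'. simpl in Hi.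
  exists 0%R, t, (INR i * t)%R. repeat split; try nra; left; nra. }
exists (exist _ (wind t) F). split; [|split].
- apply sig_eq. rewrite induced_nmul. simpl. now rewrite wind_nmul, Et.
- intros E. injection E as Ec Es.
  destruct (@expi_eq1 t) as [k Hk].
  { unfold expi. rewrite cos_0, sin_0. now rewrite Ec, Es. }
  rewrite Hk in Et, Pt.
  assert (E1 : (INR n * IZR k = 1)%R) by nra.
  rewrite INR_IZR_INZ, <- mult_IZR in E1. apply eq_IZR in E1. destruct (Z.le_gt_cases k 0); nia.
- intros i Hi.
  change (cyc zero (wind t) (proj1_sig (nmul i (exist _ (wind t) F : torsion_circle)))).
  rewrite induced_nmul. now apply C.
Qed.

(** * c-divisible groups *)

(** All that is needed from the copy of the torsion circle; for each [n] it is a first-order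
    condition, see [root_axiom]. *)
Lemma c_divisible_roots (G : structure) (n : nat) :
  c_divisible G -> (2 <= n)%nat -> exists x : G, nth_root_of_unit n x.
Proof.
intros (HG & _ & P & f & g & _ & [A C] & _ & K) Hn.
pose proof (cog_abelian (induced_cog P HG)) as AP.
pose proof (cog_abelian torsion_circle_cog) as AT.
assert (I : forall x y, g x = g y -> x = y).
{ intros x y E. now rewrite <- (K x), E. }
assert (Z : g zero = zero) by now apply additive_zero.
assert (M : forall n x, g (nmul n x) = nmul n (g x)).
{ intros m x. rewrite <- !zmul_of_nat. now apply additive_zmul. }
destruct (torsion_circle_roots Hn) as (x & H1 & H2 & H3).
exists (proj1_sig (g x)). split; [|split].
- now rewrite <- induced_nmul, <- M, H1, Z.
- intros E. apply H2, I. rewrite Z. now apply sig_eq.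
- intros i Hi. rewrite <- induced_nmul, <- M.
  assert (J : cyc (g zero) (g x) (g (nmul i x))).
  { pose proof (H3 i Hi) as J.
    destruct torsion_circle_cog as [(_ & D & _) _].
    destruct (D _ _ _ J) as (N1 & N2 & N3).
    apply C; auto; intros E; apply I in E; auto. }
  rewrite Z in J. exact J.
Qed.

Section RiegerDivisible.

Variable G : structure.
Hypothesis HG : abelian_cog G.
#[local] Instance divisible_abelian : abelian G := cog_abelian HG.

Lemma rieger_snd_nmul (n : nat) (x : rieger HG) : snd (nmul n x) = nmul n (snd x).
Proof.
induction n as [|n IH]; [easy|].
change (add (snd x) (snd (nmul n x)) = nmul (S n) (snd x)). now rewrite IH.
Qed.

(** Below [n] the multiples of [x] stay at or above [x], so no addition carries; the last one
    returns to [zero] and carries once. *)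
Lemma rieger_unit_divisible (n : nat) (x : G) : (2 <= n)%nat ->
  nth_root_of_unit n x -> nmul n ((0%Z, x) : rieger HG) = rieger_unit HG.
Proof.
intros Hn (H1 & H2 & H3).
assert (Sm : forall i, (i < n)%nat -> nmul i ((0%Z, x) : rieger HG) = (0%Z, nmul i x)).
{ induction i as [|i IH]; [easy|]. intros Hi.
  change (add ((0%Z, x) : rieger HG) (nmul i ((0%Z, x) : rieger HG)) = (0%Z, nmul (S i) x)).
  rewrite IH by lia. rewrite rieger_addE. f_equal.
  unfold carry. rewrite ind_false; [easy|]. change (~ below (nmul (S i) x) x).
  destruct i as [|i].
  - simpl. rewrite add0r. now apply below_irrefl.
  - intros K. apply (below_asym HG K). left. apply H3. lia. }
destruct n as [|n]; [lia|].
change (add ((0%Z, x) : rieger HG) (nmul n ((0%Z, x) : rieger HG)) = rieger_unit HG).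
rewrite Sm by lia. rewrite rieger_addE. unfold carry.
change (add x (nmul n x)) with (nmul (S n) x). rewrite H1.
rewrite ind_true by now apply below_0l. reflexivity.
Qed.

(** Dividing [a] in [G] solves the equation up to an integer multiple of the unit, and this error is
    corrected with an [n]-th part of the unit. *)
Lemma rieger_divisible : divisible G ->
  (forall n, (2 <= n)%nat -> exists x : G, nth_root_of_unit n x) ->
  odivisible (rieger HG).
Proof.
intros D T n [k a] Hn.
assert (U : exists u : rieger HG, zmul n u = rieger_unit HG).
{ destruct (Z.eq_dec n 1) as [->|N]; [exists (rieger_unit HG); apply zmul_1|].
  destruct (T (Z.to_nat n)) as [x Hx]; [lia|]. exists (0%Z, x).
  rewrite <- (Z2Nat.id n) by lia. rewrite zmul_of_nat.
  apply rieger_unit_divisible; [lia|easy]. }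
destruct U as [u Hu].
destruct (D (Z.to_nat n) a) as [y Hy]; [lia|].
pose (w := zmul n ((0%Z, y) : rieger HG)).
assert (Hw : snd w = a).
{ unfold w. rewrite <- (Z2Nat.id n) by lia. rewrite zmul_of_nat.
  now rewrite rieger_snd_nmul. }
exists (add ((0%Z, y) : rieger HG) (zmul (k - fst w) u)).
transitivity (add w (zmul (k - fst w) (zmul n u))); [unfold w; abel|].
rewrite Hu, rieger_add_unit, Hw. f_equal. lia.
Qed.

End RiegerDivisible.

(** Each element of the unwound torsion circle has a positive multiple among the multiples of the
    unit [u], so the map from [k u] to [k z] extends to all of it. *)
Lemma torsion_circle_embedding (L : ordgroup) (z : L) (H : structure) (p : L -> H) :
  unwinding z p -> is_group H -> odivisible L ->
  exists e : torsion_circle -> H, embedding e.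
Proof.
intros U GH D.
pose proof (cog_abelian torsion_circle_cog) as AT.
pose (T := rieger torsion_circle_cog).
pose (u := rieger_unit torsion_circle_cog : T).
assert (M : forall (K : ordgroup) (w : K), spos w ->
  omono (fun k : Z_ordgroup => zmul k w)).
{ intros K w Hw. split.
  - intros k l. apply zmul_plus.
  - intros k. symmetry. now apply pos_zmul_iff. }
destruct (@omono_extension Z_ordgroup T L (fun k => zmul k u) (fun k => zmul k z))
  as (g & Hg & E).
- apply M. apply rieger_unit_spos.
- apply M. apply U.
- easy.
- intros [k x]. destruct (proj2_sig x) as (n & Hn & Hx).
  (* As [n x] vanishes in the circle, [n (k, x)] consists of full turns only. *)
  exists (Z.of_nat n), (fst (nmul n ((k, x) : T))). split; [lia|].
  rewrite zmul_of_nat.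
  pose proof (rieger_add_unit (zero : T) (fst (nmul n ((k, x) : T)))) as F.
  rewrite add0l in F. refine (eq_trans _ (eq_sym F)).
  apply injective_projections; [reflexivity|].
  change (snd (nmul n ((k, x) : T)) = zero).
  etransitivity; [apply rieger_snd_nmul|]. apply sig_eq. rewrite induced_nmul. exact Hx.
- destruct (unwinding_embedding (rieger_unwinding torsion_circle_cog) U
    (ab_group (abelian := AT)) GH Hg) as (e & He & _).
  + rewrite <- (zmul_1 z), <- (E 1%Z). now rewrite zmul_1.
  + now exists e.
Qed.

Lemma c_divisible_embedding (G : structure) (e : torsion_circle -> G) :
  abelian_cog G -> divisible G -> embedding e -> c_divisible G.
Proof.
intros HG D (I & Z & A & N & C).
split; [easy|split; [easy|]].
assert (M0 : exists x, e x = zero) by now exists zero.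
assert (MA : forall a b, (exists x, e x = a) -> (exists x, e x = b) ->
  exists x, e x = add a b).
{ intros a b [x <-] [y <-]. now exists (add x y). }
assert (MN : forall a, (exists x, e x = a) -> exists x, e x = opp a).
{ intros a [x <-]. now exists (opp x). }
exists (Subgroup M0 MA MN).
pose (f := fun a : induced (Subgroup M0 MA MN) =>
  proj1_sig (constructive_indefinite_description _ (proj2_sig a))).
assert (Hf : forall a, e (f a) = proj1_sig a) by (intros a; apply proj2_sig).
exists f, (fun x => exist _ (e x) (ex_intro _ x eq_refl)).
split; [split|split; [split|split]].
- intros a b. apply I. now rewrite A, !Hf.
- intros a b c H _ _ _. apply C. now rewrite !Hf.
- intros x y. apply sig_eq. apply A.
- intros x y t H _ _ _. now apply C.
- intros a. apply sig_eq. apply Hf.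
- intros x. apply I, Hf.
Qed.

Lemma c_divisible_unwinding (L : ordgroup) (z : L) (H : structure) (p : L -> H) :
  unwinding z p -> is_group H -> odivisible L -> c_divisible H.
Proof.
intros U GH D. destruct (torsion_circle_embedding U GH D) as [e He].
pose proof (uw_cog U GH) as HH. pose proof (cog_abelian HH) as AH.
apply (c_divisible_embedding (e := e) HH); [|exact He].
intros n a Hn. destruct (uw_surj U a) as [x <-].
destruct (D (Z.of_nat n) x) as [y <-]; [lia|]. exists (p y).
rewrite <- zmul_of_nat. symmetry. apply (additive_zmul (uw_add U)).
Qed.

Lemma torsion_circle_c_divisible : c_divisible torsion_circle.
Proof.
apply (c_divisible_embedding (e := fun x => x)).
- exact torsion_circle_cog.
- exact torsion_circle_divisible.
- repeat split; auto.
Qed.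

Lemma c_divisible_rieger (G : structure) (HG : abelian_cog G) :
  c_divisible G -> odivisible (rieger HG).
Proof.
intros H. apply rieger_divisible; [apply H|].
intros n Hn. now apply c_divisible_roots.
Qed.

(** * Hulls and amalgams of cyclically ordered groups *)

(** For the universal property, an embedding into a c-divisible [K] is lifted to Rieger's groups,
    extended to the hull because that of [K] is divisible, and wound up again. *)
Lemma hull_exists (G : structure) : abelian_cog G ->
  exists (H : structure) (i : G -> H), c_divisible_hull i.
Proof.
intros HG. pose (L := rieger HG). pose (u := rieger_unit HG : L).
destruct (divisible_hull L) as (D & i & Hi & DD & S).
assert (Su : spos (i u)). { apply (omono_spos Hi), rieger_unit_spos. }
assert (Cu : cofinal (i u)).
{ intros w. destruct (S w) as (n & x & Hn & E).
  destruct (uw_cofinal (rieger_unwinding HG) x) as [k Hk].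
  (* From [n w = i x] and [x <= k u] one gets [n w <= n |k| (i u)], because [k <= n |k|]. *)
  exists (Z.abs k). apply (@pos_zmul_inv _ n); [easy|].
  apply Hi in Hk. fold u in Hk.
  rewrite (proj1 Hi), (additive_zmul (proj1 Hi)),
    (additive_opp (proj1 Hi)), <- E in Hk.
  assert (J : (0 <= n * Z.abs k - k)%Z) by nia.
  apply (pos_eq (pos_add Hk (pos_zmul J (spos_pos Su)))). abel. }
destruct (winding Su Cu) as (H & p & AH & U).
destruct (unwinding_embedding (rieger_unwinding HG) U (proj1 (proj1 HG))
  (ab_group (abelian := AH)) Hi eq_refl) as (e & He & Ee).
exists H, e. split; [|split].
- exact (c_divisible_unwinding U (ab_group (abelian := AH)) DD).
- now apply embedding_c_embedding.
- intros K j HK Hj. pose proof (proj1 HK) as CK.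
  pose proof (c_embedding_embedding HG CK Hj) as Ej.
  destruct (omono_extension Hi (rieger_map HG CK Ej) (c_divisible_rieger (HG := CK) HK) S)
    as (g & Hg & Eg).
  destruct (unwinding_embedding U (rieger_unwinding CK) (ab_group (abelian := AH))
    (proj1 (proj1 CK)) Hg) as (k & Hk & Ek).
  + rewrite Eg. simpl. now rewrite (proj1 (proj2 Ej)).
  + exists k. split; [now apply embedding_c_embedding|].
    intros x. change x with (snd ((0%Z, x) : L)).
    now rewrite Ee, Ek, Eg.
Qed.

(** The two units agree in the amalgam because both come from that of [M0]. That every element is a
    sum [g1 x + g2 y] yields cofinality of this unit and divisibility. *)
Lemma c_divisible_amalgam (M0 M1 M2 : structure) (f1 : M0 -> M1) (f2 : M0 -> M2) :
  c_divisible M0 -> c_divisible M1 -> c_divisible M2 -> embedding f1 -> embedding f2 ->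
  exists (N : structure) (g1 : M1 -> N) (g2 : M2 -> N),
    c_divisible N /\ embedding g1 /\ embedding g2 /\ forall x, g1 (f1 x) = g2 (f2 x).
Proof.
intros D0 D1 D2 E1 E2.
pose proof (proj1 D0) as H0. pose proof (proj1 D1) as H1. pose proof (proj1 D2) as H2.
pose proof (rieger_map H0 H1 E1) as R1. pose proof (rieger_map H0 H2 E2) as R2.
destruct (amalgam R1 R2 (c_divisible_rieger (HG := H0) D0)) as (L & g1 & g2 & K1 & K2 & C & G).
set (r1 := fun x : rieger H0 => _) in R1, C. set (r2 := fun x : rieger H0 => _) in R2, C.
pose (z := g1 (rieger_unit H1)).
assert (Ez : z = g2 (rieger_unit H2)).
{ unfold z.
  assert (F1 : r1 (rieger_unit H0) = rieger_unit H1).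
  { unfold r1, rieger_unit. simpl. now rewrite (proj1 (proj2 E1)). }
  assert (F2 : r2 (rieger_unit H0) = rieger_unit H2).
  { unfold r2, rieger_unit. simpl. now rewrite (proj1 (proj2 E2)). }
  rewrite <- F1, <- F2. apply C. }
assert (Sz : spos z) by (apply (omono_spos K1), rieger_unit_spos).
assert (Cz : cofinal z).
{ intros w. destruct (G w) as (x & y & ->).
  destruct (uw_cofinal (rieger_unwinding H1) x) as [k Hk].
  destruct (uw_cofinal (rieger_unwinding H2) y) as [l Hl].
  apply K1 in Hk. apply K2 in Hl. exists (k + l)%Z.
  rewrite (proj1 K1), (additive_zmul (proj1 K1)), (additive_opp (proj1 K1)) in Hk.
  rewrite (proj1 K2), (additive_zmul (proj1 K2)), (additive_opp (proj1 K2)), <- Ez in Hl.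
  apply (pos_eq (pos_add Hk Hl)). unfold z. abel. }
assert (DL : odivisible L).
{ intros n w Hn. destruct (G w) as (x & y & ->).
  destruct (c_divisible_rieger (HG := H1) D1 (n := n) x Hn) as [x' <-].
  destruct (c_divisible_rieger (HG := H2) D2 (n := n) y Hn) as [y' <-].
  exists (add (g1 x') (g2 y')).
  rewrite (additive_zmul (proj1 K1)), (additive_zmul (proj1 K2)). abel. }
destruct (winding Sz Cz) as (N & p & AN & U).
destruct (unwinding_embedding (rieger_unwinding H1) U (proj1 (proj1 H1))
  (ab_group (abelian := AN)) K1 eq_refl) as (e1 & Y1 & X1).
destruct (unwinding_embedding (rieger_unwinding H2) U (proj1 (proj1 H2))
  (ab_group (abelian := AN)) K2 (eq_sym Ez)) as (e2 & Y2 & X2).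
exists N, e1, e2.
split; [exact (c_divisible_unwinding U (ab_group (abelian := AN)) DL)|].
split; [exact Y1|split; [exact Y2|]].
intros x. pose proof (C (0%Z, x)) as E. apply (f_equal p) in E.
rewrite <- X1, <- X2 in E. exact E.
Qed.

(** * Formulas *)

Lemma eval_ext (M : structure) (v w : nat -> M) (t : term) :
  (forall k, occurs k t -> v k = w k) -> eval v t = eval w t.
Proof.
induction t as [n| |s IHs t IHt|t IHt]; simpl; intros H; auto.
- rewrite IHs, IHt; auto.
- rewrite IHt; auto.
Qed.

Lemma sat_ext (M : structure) (p : formula) (v w : nat -> M) :
  (forall k, free k p -> v k = w k) -> (sat v p <-> sat w p).
Proof.
revert v w.
assert (S : forall p, (forall v w : nat -> M, (forall k, free k p -> v k = w k) ->
    (sat v p <-> sat w p)) ->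
  forall v w : nat -> M, (forall k, free (S k) p -> v k = w k) ->
  forall a, sat (scons a v) p <-> sat (scons a w) p).
{ intros q IH v w H a. apply IH. intros [|k] Hk; simpl; auto. }
induction p as [s t|s t u| |p IHp q IHq|p IHp q IHq|p IHp q IHq|p IHp|p IHp];
  simpl; intros v w H; try tauto.
- rewrite (@eval_ext _ v w s), (@eval_ext _ v w t) by auto. tauto.
- rewrite (@eval_ext _ v w s), (@eval_ext _ v w t), (@eval_ext _ v w u) by auto. tauto.
- rewrite (IHp v w), (IHq v w) by auto. tauto.
- rewrite (IHp v w), (IHq v w) by auto. tauto.
- rewrite (IHp v w), (IHq v w) by auto. tauto.
- split; intros K a; now apply (S p IHp v w H).
- split; intros [a K]; exists a; now apply (S p IHp v w H).
Qed.

Lemma eval_embedding (M N : structure) (f : M -> N) (v : nat -> M) (t : term) :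
  embedding f -> f (eval v t) = eval (fun n => f (v n)) t.
Proof.
intros (_ & Z & A & O & _).
induction t as [n| |s IHs t IHt|t IHt]; simpl; auto.
- now rewrite A, IHs, IHt.
- now rewrite O, IHt.
Qed.

Lemma sat_embedding (M N : structure) (f : M -> N) (p : formula) (v : nat -> M) :
  embedding f -> quantifier_free p -> (sat v p <-> sat (fun n => f (v n)) p).
Proof.
intros Hf. pose proof Hf as (I & _ & _ & _ & C).
induction p as [s t|s t u| |p IHp q IHq|p IHp q IHq|p IHp q IHq|p IHp|p IHp];
  simpl; try tauto; intros _.
- rewrite <- !(eval_embedding _ _ Hf). split; [now intros ->|apply I].
- rewrite <- !(eval_embedding _ _ Hf). apply C.
Qed.

Fixpoint tsubst (s : nat -> term) (t : term) : term :=
  match t with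
  | Var n => s n
  | Zero => Zero
  | Add t u => Add (tsubst s t) (tsubst s u)
  | Opp t => Opp (tsubst s t)
  end.

(** Only meaningful on quantifier-free formulas. *)
Fixpoint fsubst (s : nat -> term) (p : formula) : formula :=
  match p with
  | Eq t u => Eq (tsubst s t) (tsubst s u)
  | Rel t u w => Rel (tsubst s t) (tsubst s u) (tsubst s w)
  | Bot => Bot
  | Imp p q => Imp (fsubst s p) (fsubst s q)
  | And p q => And (fsubst s p) (fsubst s q)
  | Or p q => Or (fsubst s p) (fsubst s q)
  | All p => All p
  | Ex p => Ex p
  end.

Lemma eval_tsubst (M : structure) (v : nat -> M) (s : nat -> term) (t : term) :
  eval v (tsubst s t) = eval (fun n => eval v (s n)) t.
Proof. induction t; simpl; congruence. Qed.

Lemma sat_fsubst (M : structure) (v : nat -> M) (s : nat -> term) (p : formula) :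
  quantifier_free p -> (sat v (fsubst s p) <-> sat (fun n => eval v (s n)) p).
Proof. induction p; simpl; rewrite ?eval_tsubst; tauto. Qed.

Lemma quantifier_free_fsubst (s : nat -> term) (p : formula) :
  quantifier_free p -> quantifier_free (fsubst s p).
Proof. induction p; simpl; tauto. Qed.

Lemma occurs_tsubst (s : nat -> term) (k : nat) (t : term) :
  occurs k (tsubst s t) -> exists n, occurs k (s n).
Proof. induction t; simpl; try tauto. intros H. now exists n. Qed.

Lemma free_fsubst (s : nat -> term) (k : nat) (p : formula) :
  quantifier_free p -> free k (fsubst s p) -> exists n, occurs k (s n).
Proof.
induction p; simpl; try tauto; intros _ H;
  repeat destruct H as [H|H]; now apply occurs_tsubst in H.
Qed.

Definition Top : formula := Imp Bot Bot.

Fixpoint nterm (n : nat) (t : term) : term :=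
  match n with 0%nat => Zero | S n => Add t (nterm n t) end.

Lemma eval_nterm (M : structure) (v : nat -> M) (n : nat) (t : term) :
  eval v (nterm n t) = nmul n (eval v t).
Proof. induction n as [|n IH]; simpl; congruence. Qed.

Lemma occurs_nterm (k n : nat) (t : term) : occurs k (nterm n t) -> occurs k t.
Proof. induction n; simpl; tauto. Qed.

(** * Axioms *)

(** Mirrors [abelian_cog] clause by clause, so that its satisfaction unfolds to it by conversion. *)
Definition cog_axiom : formula :=
  let ne s t := Not (Eq s t) in
  And (And
    (And (All (All (All (Eq (Add (Var 2) (Add (Var 1) (Var 0)))
                            (Add (Add (Var 2) (Var 1)) (Var 0))))))
    (And (All (Eq (Add Zero (Var 0)) (Var 0)))
    (And (All (Eq (Add (Var 0) Zero) (Var 0)))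
    (And (All (Eq (Add (Opp (Var 0)) (Var 0)) Zero))
         (All (Eq (Add (Var 0) (Opp (Var 0))) Zero))))))
    (And (All (All (All (Imp (Rel (Var 2) (Var 1) (Var 0))
      (And (ne (Var 2) (Var 1)) (And (ne (Var 1) (Var 0)) (ne (Var 2) (Var 0))))))))
    (And (All (All (All (Imp (Rel (Var 2) (Var 1) (Var 0)) (Rel (Var 1) (Var 0) (Var 2))))))
    (And (All (And
      (All (Imp (ne (Var 0) (Var 1)) (Not (Rel (Var 1) (Var 0) (Var 0)))))
      (And
      (All (All (All (Imp (ne (Var 2) (Var 3)) (Imp (ne (Var 1) (Var 3))
        (Imp (ne (Var 0) (Var 3)) (Imp (Rel (Var 3) (Var 2) (Var 1))
        (Imp (Rel (Var 3) (Var 1) (Var 0)) (Rel (Var 3) (Var 2) (Var 0))))))))))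
      (All (All (Imp (ne (Var 1) (Var 2)) (Imp (ne (Var 0) (Var 2))
        (Imp (ne (Var 1) (Var 0))
        (Or (Rel (Var 2) (Var 1) (Var 0)) (Rel (Var 2) (Var 0) (Var 1)))))))))))
    (All (All (All (All (All (Imp (Rel (Var 4) (Var 3) (Var 2))
      (Rel (Add (Add (Var 1) (Var 4)) (Var 0)) (Add (Add (Var 1) (Var 3)) (Var 0))
        (Add (Add (Var 1) (Var 2)) (Var 0)))))))))))))
  (All (All (Eq (Add (Var 1) (Var 0)) (Add (Var 0) (Var 1))))).

Lemma sat_cog_axiom (M : structure) (v : nat -> M) : sat v cog_axiom <-> abelian_cog M.
Proof. reflexivity. Qed.

Definition divisible_axiom (n : nat) : formula :=
  All (Ex (Eq (nterm n (Var 0)) (Var 1))).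

Definition root_axiom (n : nat) : formula :=
  Ex (And (Eq (nterm n (Var 0)) Zero) (And (Not (Eq (Var 0) Zero))
    (fold_right And Top
      (map (fun i => Rel Zero (Var 0) (nterm i (Var 0))) (seq 2 (n - 2)))))).

Lemma sat_conj (M : structure) (v : nat -> M) (l : list formula) :
  sat v (fold_right And Top l) <-> forall p, In p l -> sat v p.
Proof.
induction l as [|q l IH]; simpl; [tauto|]. rewrite IH. split.
- intros [H K] p [<-|Hp]; auto.
- auto.
Qed.

Lemma free_conj (k : nat) (l : list formula) :
  free k (fold_right And Top l) -> exists p, In p l /\ free k p.
Proof.
induction l as [|q l IH]; simpl; [tauto|]. intros [H|H].
- exists q; auto.
- destruct (IH H) as (p & Hp & K). exists p; auto.
Qed.

Lemma sat_root_axiom (M : structure) (v : nat -> M) (n : nat) :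
  sat v (root_axiom n) <-> exists x : M, nth_root_of_unit n x.
Proof.
assert (E : forall x : M, sat (scons x v) (fold_right And Top
    (map (fun i => Rel Zero (Var 0) (nterm i (Var 0))) (seq 2 (n - 2)))) <->
  forall i, (2 <= i < n)%nat -> cyc zero x (nmul i x)).
{ intros x. rewrite sat_conj. split.
  - intros H i Hi. specialize (H (Rel Zero (Var 0) (nterm i (Var 0)))).
    simpl in H. rewrite eval_nterm in H. apply H. apply in_map_iff.
    exists i. split; [easy|]. apply in_seq. lia.
  - intros H p (i & <- & Hi)%in_map_iff. simpl. rewrite eval_nterm. apply H.
    apply in_seq in Hi. lia. }
split; intros (x & H); exists x.
- destruct H as (H1 & H2 & H3). simpl in H1. rewrite eval_nterm in H1.
  split; [easy|split; [easy|exact (proj1 (E x) H3)]].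
- destruct H as (H1 & H2 & H3). split; [simpl; now rewrite eval_nterm|].
  split; [easy|exact (proj2 (E x) H3)].
Qed.

Lemma model_axiom (K : structure -> Prop) (M : structure) (p : formula) (v : nat -> M) :
  model (theory_of K) M -> sentence p ->
  (forall (N : structure) (w : nat -> N), K N -> sat w p) -> sat v p.
Proof. intros H S A. apply H. split; [easy|]. intros N HN w. now apply A. Qed.

Lemma sentence_cog_axiom : sentence cog_axiom.
Proof. intros k. simpl. intuition discriminate. Qed.

Lemma model_Tcog (M : structure) : model Tcog M <-> abelian_cog M.
Proof.
split.
- intros H. apply (sat_cog_axiom (fun _ => zero : M)).
  apply (model_axiom (fun _ => zero : M) H sentence_cog_axiom). intros N w HN. apply sat_cog_axiom, HN.
- intros H p [_ Hp]. now apply Hp.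
Qed.

(** The sentences used are [cog_axiom], [divisible_axiom] and [root_axiom]. They make the unwinding
    divisible, and [c_divisible_unwinding] then produces the subgroup required by [c_divisible]. *)
Lemma model_TcD (M : structure) : model TcD M <-> c_divisible M.
Proof.
split; [|intros H p [_ Hp]; now apply Hp].
intros H.
assert (HM : abelian_cog M).
{ apply (sat_cog_axiom (fun _ => zero : M)).
  apply (model_axiom (fun _ => zero : M) H sentence_cog_axiom). intros N w HN.
  apply sat_cog_axiom, HN. }
apply (c_divisible_unwinding (rieger_unwinding HM) (proj1 (proj1 HM))).
apply rieger_divisible.
- intros n x Hn.
  assert (A : sat (fun _ => zero : M) (divisible_axiom n)).
  { apply (model_axiom (fun _ => zero : M) H).
    - intros k. simpl. intros [K|K]; [apply occurs_nterm in K|]; discriminate K.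
    - intros N w (_ & D & _) y. destruct (D n y Hn) as [u Hu]. exists u.
      simpl. now rewrite eval_nterm. }
  destruct (A x) as [y Hy]. exists y. simpl in Hy. now rewrite eval_nterm in Hy.
- intros n Hn. apply (sat_root_axiom (fun _ => zero : M)).
  apply (model_axiom (fun _ => zero : M) H).
  + intros k. cbn [root_axiom free occurs]. intros [[K|[]]|[[[K|[]]|[]]|K]].
    * apply occurs_nterm in K. discriminate K.
    * discriminate K.
    * apply free_conj in K as (p & (i & <- & _)%in_map_iff & K).
      destruct K as [[]|[K|K]]; [|apply occurs_nterm in K]; discriminate K.
  + intros N w HN. apply sat_root_axiom. now apply c_divisible_roots.
Qed.

(** * Elimination of a variable over divisible ordered groups *)

Definition same_sign (L1 L2 : ordgroup) (x : L1) (y : L2) : Prop :=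
  (pos x <-> pos y) /\ (pos (opp x) <-> pos (opp y)).

Section SameSign.

Variables L1 L2 : ordgroup.
Implicit Types (x : L1) (y : L2).
Open Scope grp_scope.

Lemma same_sign_sym x y : same_sign x y -> same_sign y x.
Proof. unfold same_sign. tauto. Qed.

Lemma same_sign_zero x y : same_sign x y -> (x = zero <-> y = zero).
Proof.
assert (Z : forall (L : ordgroup) (u : L), u = zero <-> pos u /\ pos (- u)).
{ intros L u. split; [intros ->; rewrite opp0; split; apply pos_zero|].
  intros []. now apply pos_anti. }
unfold same_sign. rewrite !Z. tauto.
Qed.

Lemma same_sign_spos x y : same_sign x y -> (spos x <-> spos y).
Proof. unfold same_sign, spos. tauto. Qed.

Lemma same_sign_opp x y : same_sign x y -> same_sign (- x) (- y).
Proof. unfold same_sign. rewrite !oppK. tauto. Qed.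

Lemma spos_same_sign x y : spos x -> spos y -> same_sign x y.
Proof.
intros Hx Hy. split; split; intros H; try now apply spos_pos.
all: now destruct (Hx H) || destruct (Hy H).
Qed.

Lemma same_sign_zmul k x y : same_sign x y -> same_sign (zmul k x) (zmul k y).
Proof.
assert (P : forall (L : ordgroup) n (u : L), (0 < n)%Z -> pos (zmul n u) <-> pos u).
{ intros L n u Hn. split; [now apply pos_zmul_inv|apply pos_zmul; lia]. }
assert (S : forall n, (0 < n)%Z -> same_sign x y -> same_sign (zmul n x) (zmul n y)).
{ intros n Hn [H K]. split; rewrite <- ?zmul_opp_r, !P; easy. }
intros H. destruct (Z.lt_trichotomy k 0) as [Hk|[->|Hk]].
- replace k with (- - k)%Z by lia. rewrite !(zmul_opp (- k)).
  apply same_sign_opp, S; [lia|easy].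
- split; rewrite ?opp0; split; intros; apply pos_zero || (simpl; rewrite opp0; apply pos_zero).
- now apply S.
Qed.

(** Multiplying by [k] once more makes the factor [k * k], positive whatever the sign of [k]. *)
Lemma same_sign_zmul_inv k x y :
  k <> 0%Z -> same_sign (zmul k x) (zmul k y) -> same_sign x y.
Proof.
intros Hk H. apply (same_sign_zmul k) in H.
assert (P : forall (L : ordgroup) (u : L), pos u <-> pos (zmul k (zmul k u))).
{ intros L u. rewrite <- zmul_mul.
  assert (0 < k * k)%Z by nia.
  split; [apply pos_zmul; lia|now apply pos_zmul_inv]. }
destruct H as [H K].
split; [now rewrite (P L1), (P L2)|].
rewrite (P L1), (P L2), !zmul_opp_r. exact K.
Qed.

End SameSign.

Lemma exists_largest (A : Type) (L : ordgroup) (Q : A -> Prop) (h : A -> L) (l : list A) :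
  (forall a, In a l -> ~ Q a) \/
  exists m, In m l /\ Q m /\ forall a, In a l -> Q a -> pos (add (h m) (opp (h a))).
Proof.
induction l as [|b l IH]; [now left|].
destruct (classic (Q b)) as [Hb|Hb].
- right. destruct IH as [IH|(m & Hm & Qm & IH)].
  + exists b. split; [now left|split; [easy|]]. intros a [<-|Ha] Qa.
    * rewrite addNr. apply pos_zero.
    * now destruct (IH a Ha).
  + destruct (pos_total (add (h m) (opp (h b)))) as [K|K].
    * exists m. split; [now right|split; [easy|]]. intros a [<-|Ha] Qa; auto.
    * exists b. split; [now left|split; [easy|]]. intros a [<-|Ha] Qa.
      -- rewrite addNr. apply pos_zero.
      -- apply (pos_eq (pos_add K (IH a Ha Qa))). abel.
- destruct IH as [IH|(m & Hm & Qm & IH)].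
  + left. intros a [<-|Ha]; auto.
  + right. exists m. split; [now right|split; [easy|]]. intros a [<-|Ha] Qa; auto.
    now destruct Hb.
Qed.

(** One step of Cantor's back-and-forth between dense orders without endpoints. *)
Lemma dense_extension (L1 L2 : ordgroup) (z : L2) (l : list (L1 * L2)) :
  odivisible L2 -> spos z ->
  (forall a b, In a l -> In b l ->
    same_sign (add (fst a) (opp (fst b))) (add (snd a) (opp (snd b)))) ->
  forall c, exists d, forall a, In a l ->
    same_sign (add c (opp (fst a))) (add d (opp (snd a))).
Proof.
intros D Hz H c.
destruct (classic (exists a, In a l /\ c = fst a)) as [(a & Ha & ->)|N].
{ exists (snd a). intros b Hb. now apply H. }
pose (lo := fun a : L1 * L2 => spos (add c (opp (fst a)))).
pose (hi := fun a : L1 * L2 => spos (add (fst a) (opp c))).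
assert (LH : forall a, In a l -> lo a \/ hi a).
{ intros a Ha. apply or_comm. apply spos_trichotomy. intros E. apply N. now exists a. }
assert (S : exists d, forall a, In a l ->
  (lo a -> spos (add d (opp (snd a)))) /\ (hi a -> spos (add (snd a) (opp d)))).
(* Here [m] gives the greatest lower point and, through the negated values, [n] the least upper one.
   The new point is their midpoint, or lies at distance [z] beyond the only one that exists. *)
{ destruct (exists_largest lo snd l) as [Nlo|(m & Hm & Lm & Mm)];
    destruct (exists_largest hi (fun a => opp (snd a)) l) as [Nhi|(n & Hn & Ln & Mn)].
  - exists zero. intros a Ha. split; intros K; [now destruct (Nlo a)|now destruct (Nhi a)].
  - exists (add (snd n) (opp z)). intros a Ha. split; intros K.
    + now destruct (Nlo a).
    + refine (spos_eq (spos_add Hz (Mn a Ha K)) _). abel.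
  - exists (add (snd m) z). intros a Ha. split; intros K.
    + refine (spos_eq (spos_add Hz (Mm a Ha K)) _). abel.
    + now destruct (Nhi a).
  - destruct (D 2%Z (add (snd m) (snd n))) as [d Hd]; [easy|].
    assert (G : spos (add (snd n) (opp (snd m)))).
    { apply (same_sign_spos (H n m Hn Hm)).
      refine (spos_eq (spos_add Ln (spos_pos Lm)) _). abel. }
    assert (P : forall u : L2, spos (zmul 2 u) -> spos u).
    { intros u Hu K. apply Hu. apply (pos_eq (pos_add K K)). abel. }
    exists d. intros a Ha. split; intros K.
    + assert (K' : spos (add d (opp (snd m)))).
      { apply P. apply (spos_eq G). rewrite zmul_add, Hd. abel. }
      refine (spos_eq (spos_add K' (Mm a Ha K)) _). abel.
    + assert (K' : spos (add (snd n) (opp d))).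
      { apply P. apply (spos_eq G). rewrite zmul_add, zmul_opp_r, Hd. abel. }
      refine (spos_eq (spos_add K' (Mn a Ha K)) _). abel. }
destruct S as [d Hd]. exists d. intros a Ha. destruct (Hd a Ha) as [K1 K2].
destruct (LH a Ha) as [K|K].
- apply spos_same_sign; auto.
- specialize (K2 K). rewrite <- (oppK (add c _)), <- (oppK (add d _)).
  apply same_sign_opp, spos_same_sign.
  + apply (spos_eq K). abel.
  + apply (spos_eq K2). abel.
Qed.

(** The pair [(t, k)] stands for the linear form [t + k z]. *)
Definition form : Type := (term * Z)%type.

Definition fval (L : ordgroup) (z : L) (v : nat -> L) (f : form) : L :=
  add (eval v (fst f)) (zmul (snd f) z).

Fixpoint coef0 (t : term) : Z :=
  match t with
  | Var 0 => 1
  | Var (S _) | Zero => 0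
  | Add s t => coef0 s + coef0 t
  | Opp t => - coef0 t
  end.

Fixpoint rest (t : term) : term :=
  match t with
  | Var 0 => Zero
  | Var (S n) => Var n
  | Zero => Zero
  | Add s t => Add (rest s) (rest t)
  | Opp t => Opp (rest t)
  end.

Definition tmul (k : Z) (t : term) : term :=
  if Z.ltb k 0 then Opp (nterm (Z.to_nat (- k)) t) else nterm (Z.to_nat k) t.

Definition frest (f : form) : form := (rest (fst f), snd f).

(** The product of the two leading coefficients times the zero of [f] minus the zero of [g], both
    taken in [Var 0]; so its sign tells how the zeros are ordered. *)
Definition resultant (f g : form) : form :=
  (Add (tmul (coef0 (fst f)) (rest (fst g))) (Opp (tmul (coef0 (fst g)) (rest (fst f)))),
   coef0 (fst f) * snd g - coef0 (fst g) * snd f)%Z.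

(** The first part provides the forms in which [Var 0] has coefficient zero. *)
Definition elim (l : list form) : list form :=
  map frest l ++ flat_map (fun f => map (resultant f) l) l.

Lemma eval_tmul (G : structure) {AG : abelian G} (v : nat -> G) (k : Z) (t : term) :
  eval v (tmul k t) = zmul k (eval v t).
Proof.
unfold tmul. destruct (Z.ltb_spec k 0) as [H|H]; simpl; rewrite eval_nterm, <- zmul_of_nat.
- rewrite Z2Nat.id by lia. abel.
- now rewrite Z2Nat.id by lia.
Qed.

Lemma eval_scons (G : structure) {AG : abelian G} (v : nat -> G) (c : G) (t : term) :
  eval (scons c v) t = add (zmul (coef0 t) c) (eval v (rest t)).
Proof.
induction t as [[|n]| |s IHs t IHt|t IHt]; cbn [eval coef0 rest scons].
- abel.
- abel.
- abel.
- rewrite IHs, IHt. abel.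
- rewrite IHt. abel.
Qed.

Section FormValues.

Open Scope grp_scope.

Lemma fval_scons (L : ordgroup) (z c : L) (v : nat -> L) (f : form) :
  fval z (scons c v) f = zmul (coef0 (fst f)) c + fval z v (frest f).
Proof. unfold fval. cbn [frest fst snd].
rewrite (eval_scons (AG := og_abelian L)). abel. Qed.

Lemma fval_resultant (L : ordgroup) (z : L) (v : nat -> L) (f g : form) :
  fval z v (resultant f g) =
  zmul (coef0 (fst f)) (fval z v (frest g)) - zmul (coef0 (fst g)) (fval z v (frest f)).
Proof.
unfold fval, resultant, frest. cbn [fst snd eval].
rewrite !(eval_tmul (AG := og_abelian L)). abel.
Qed.

Lemma odivisible_zmul (L : ordgroup) (k : Z) (x : L) :
  odivisible L -> k <> 0%Z -> exists y, zmul k y = x.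
Proof.
intros D Hk. destruct (Z.lt_trichotomy k 0) as [H|[H|H]]; [|easy|now apply D].
destruct (D (- k)%Z (- x)) as [y Hy]; [lia|]. exists y.
apply (f_equal opp) in Hy. rewrite oppK in Hy. rewrite <- Hy. abel.
Qed.

End FormValues.

Section Elimination.

Variables (L1 L2 : ordgroup) (z1 : L1) (z2 : L2) (v1 : nat -> L1) (v2 : nat -> L2).
Hypotheses (D1 : odivisible L1) (D2 : odivisible L2) (Hz2 : spos z2).
Open Scope grp_scope.

(** The form [f] vanishes when [Var 0] takes the value [x]. *)
Let P1 (f : form) (x : L1) : Prop := zmul (coef0 (fst f)) x = - fval z1 v1 (frest f).
Let P2 (f : form) (x : L2) : Prop := zmul (coef0 (fst f)) x = - fval z2 v2 (frest f).

Lemma breakpoints (l : list form) : exists b : list (L1 * L2),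
  (forall f, In f l -> coef0 (fst f) <> 0%Z ->
     exists a, In a b /\ P1 f (fst a) /\ P2 f (snd a)) /\
  (forall a, In a b ->
     exists f, In f l /\ coef0 (fst f) <> 0%Z /\ P1 f (fst a) /\ P2 f (snd a)).
Proof.
induction l as [|f l (b & B1 & B2)]; [now exists nil|].
destruct (Z.eq_dec (coef0 (fst f)) 0) as [E|E].
- exists b. split.
  + intros g [<-|Hg]; [tauto|auto].
  + intros a Ha. destruct (B2 a Ha) as (g & Hg & K). exists g. split; [now right|easy].
- destruct (odivisible_zmul (- fval z1 v1 (frest f)) D1 E) as [x Hx].
  destruct (odivisible_zmul (- fval z2 v2 (frest f)) D2 E) as [y Hy].
  exists ((x, y) :: b). split.
  + intros g [<-|Hg] Eg.
    * exists (x, y). split; [now left|easy].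
    * destruct (B1 g Hg Eg) as (a & Ha & K). exists a. split; [now right|easy].
  + intros a [<-|Ha].
    * exists f. split; [now left|easy].
    * destruct (B2 a Ha) as (g & Hg & K). exists g. split; [now right|easy].
Qed.

(** The sign of a form at [c] depends on its leading coefficient and on the side of its zero on
    which [c] lies. The resultants order the zeros alike in [L1] and [L2], so [dense_extension]
    finds a [d] in the corresponding position. *)
Lemma elim_extension (l : list form) :
  (forall f, In f (elim l) -> same_sign (fval z1 v1 f) (fval z2 v2 f)) ->
  forall c, exists d, forall f, In f l ->
    same_sign (fval z1 (scons c v1) f) (fval z2 (scons d v2) f).
Proof.
intros H c. destruct (breakpoints l) as (b & B1 & B2).
assert (HR : forall f g, In f l -> In g l ->
  same_sign (fval z1 v1 (resultant f g)) (fval z2 v2 (resultant f g))).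
{ intros f g Hf Hg. apply H, in_app_iff. right. apply in_flat_map.
  exists f. split; [easy|now apply in_map]. }
destruct (@dense_extension L1 L2 z2 b D2 Hz2) with (c := c) as [d Hd].
{ intros a a' Ha Ha'.
  destruct (B2 a Ha) as (f & Hf & Ef & F1 & F2).
  destruct (B2 a' Ha') as (g & Hg & Eg & G1 & G2).
  apply (@same_sign_zmul_inv _ _ (coef0 (fst f) * coef0 (fst g))%Z); [nia|].
  assert (E : forall (L : ordgroup) (x y r s : L),
    zmul (coef0 (fst f)) x = - r -> zmul (coef0 (fst g)) y = - s ->
    zmul (coef0 (fst f) * coef0 (fst g)) (x - y) =
    zmul (coef0 (fst f)) s - zmul (coef0 (fst g)) r).
  { intros L x y r s Hx Hy.
    transitivity (zmul (coef0 (fst g)) (zmul (coef0 (fst f)) x) -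
      zmul (coef0 (fst f)) (zmul (coef0 (fst g)) y)); [abel|].
    rewrite Hx, Hy. abel. }
  rewrite (E _ _ _ _ _ F1 G1), (E _ _ _ _ _ F2 G2), <- !fval_resultant.
  now apply HR. }
exists d. intros f Hf. rewrite !fval_scons.
destruct (Z.eq_dec (coef0 (fst f)) 0) as [E|E].
- rewrite E. simpl. rewrite !add0l. apply H, in_app_iff. left. now apply in_map.
- destruct (B1 f Hf E) as (a & Ha & F1 & F2).
  replace (zmul (coef0 (fst f)) c + fval z1 v1 (frest f))
    with (zmul (coef0 (fst f)) (c - fst a))
    by (rewrite zmul_add, zmul_opp_r, F1; abel).
  replace (zmul (coef0 (fst f)) d + fval z2 v2 (frest f))
    with (zmul (coef0 (fst f)) (d - snd a))
    by (rewrite zmul_add, zmul_opp_r, F2; abel).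
  apply same_sign_zmul. now apply Hd.
Qed.

End Elimination.

(** * The truth value of a formula depends on finitely many signs *)

Definition lift (M : structure) (HM : abelian_cog M) (v : nat -> M) (n : nat) : rieger HM :=
  (0%Z, v n).

(** Number of turns made by a sum of elements of the fundamental domain. *)
Definition turns (M : structure) (HM : abelian_cog M) (v : nat -> M) (t : term) : Z :=
  fst (eval (lift HM v) t).

(** Each addition carries at most once and each negation borrows at most once. *)
Fixpoint turns_bound (t : term) : nat :=
  match t with
  | Var _ | Zero => 0
  | Add s t => turns_bound s + turns_bound t + 1
  | Opp t => turns_bound t + 1
  end.

(** All shifts of [t] by [- b] to [b] turns; since [t] makes at most [b] turns in absolute value,
    their signs determine its exact number of turns and whether it vanishes in [G]. *)
Definition signs_of (t : term) : list form :=
  let b := turns_bound t in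
  map (fun k => (t, Z.of_nat k - Z.of_nat b)%Z) (seq 0 (2 * b + 1)).

Definition Diff (s t : term) : term := Add s (Opp t).

(** The terms listed for [Rel] are those of [cyc_turns]. Under a quantifier the forms [Var 0] and
    [Var 0 - z] are added, to keep the bound variable in the fundamental domain. *)
Fixpoint signs (p : formula) : list form :=
  match p with
  | Eq s t => signs_of (Diff s t)
  | Rel s t u =>
      signs_of (Diff t s) ++ signs_of (Diff u s) ++ signs_of (Diff (Diff u s) (Diff t s))
  | Bot => []
  | Imp p q | And p q | Or p q => signs p ++ signs q
  | All p | Ex p => elim ((Var 0, 0%Z) :: (Var 0, (-1)%Z) :: signs p)
  end.

Section Transfer.

Variable M : structure.
Hypothesis HM : abelian_cog M.
Variable v : nat -> M.

#[local] Instance transfer_abelian : abelian M := cog_abelian HM.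

Lemma snd_eval_lift (t : term) : snd (eval (lift HM v) t) = eval v t.
Proof.
induction t as [n| |s IHs t IHt|t IHt]; try easy.
- change (add (snd (eval (lift HM v) s)) (snd (eval (lift HM v) t)) = eval v (Add s t)).
  now rewrite IHs, IHt.
- change (opp (snd (eval (lift HM v) t)) = eval v (Opp t)). now rewrite IHt.
Qed.

Lemma eval_lift (t : term) : eval (lift HM v) t = (turns HM v t, eval v t).
Proof. rewrite <- snd_eval_lift. apply surjective_pairing. Qed.

Lemma turns_Add (s t : term) :
  turns HM v (Add s t) = (turns HM v s + turns HM v t + carry (eval v s) (eval v t))%Z.
Proof. rewrite <- !snd_eval_lift. reflexivity. Qed.

Lemma turns_Opp (t : term) :
  turns HM v (Opp t) = (- turns HM v t - ind (eval v t <> zero))%Z.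
Proof.
rewrite <- (carry_opp HM), <- snd_eval_lift. reflexivity.
Qed.

Lemma ind_range (P : Prop) : (0 <= ind P <= 1)%Z.
Proof. unfold ind. destruct (excluded_middle_informative P); lia. Qed.

Lemma turns_range (t : term) : (Z.abs (turns HM v t) <= Z.of_nat (turns_bound t))%Z.
Proof.
induction t as [n| |s IHs t IHt|t IHt]; try (simpl; lia).
- rewrite turns_Add. pose proof (carry_range (eval v s) (eval v t)). simpl. lia.
- rewrite turns_Opp. pose proof (ind_range (eval v t <> zero)). simpl. lia.
Qed.

Lemma fval_lift (f : form) :
  fval (rieger_unit HM) (lift HM v) f = ((turns HM v (fst f) + snd f)%Z, eval v (fst f)).
Proof. unfold fval. rewrite rieger_add_unit, eval_lift. reflexivity. Qed.

(** After translating [s] to [zero], the claim is that [x] is nonzero and below [y]. By [rieger_sub]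
    the last expression is minus the borrow of [y - x], so it is nonnegative exactly if [y] is not
    below [x]. *)
Lemma cyc_turns (s t u : term) :
  let x := Diff t s in let y := Diff u s in
  cyc (eval v s) (eval v t) (eval v u) <->
  eval v x <> zero /\ eval v (Diff y x) <> zero /\
  (0 <= turns HM v (Diff y x) - turns HM v y + turns HM v x)%Z.
Proof.
intros x y. rewrite (cyc_translate HM _ _ _ (opp (eval v s))), addNr.
change (add (eval v t) (opp (eval v s))) with (eval v x).
change (add (eval v u) (opp (eval v s))) with (eval v y).
assert (E : cyc zero (eval v x) (eval v y) <->
  eval v x <> zero /\ below (eval v x) (eval v y)).
{ split.
  - intros H. destruct (cyc_distinct HM H) as (N & _). split; [congruence|now left].
  - intros [N [H|H]]; tauto. }
assert (F : turns HM v (Diff y x) =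
  (turns HM v y - turns HM v x - ind (below (eval v y) (eval v x)))%Z).
{ change (turns HM v (Diff y x))
    with (fst (add (eval (lift HM v) y) (opp (eval (lift HM v) x)))).
  now rewrite !eval_lift, rieger_sub. }
assert (N : eval v (Diff y x) <> zero <-> eval v y <> eval v x).
{ change (eval v (Diff y x)) with (add (eval v y) (opp (eval v x))).
  now rewrite (sub_eq0 HM). }
rewrite E, F, N. unfold ind.
destruct (excluded_middle_informative _) as [H|H].
- split; [|lia]. intros [_ K]. now destruct (below_asym HM H K).
- split.
  + intros [H1 H2]. split; [easy|]. split; [|lia]. intros K. rewrite K in H2.
    now apply (below_irrefl HM) in H2.
  + intros (H1 & H2 & _). split; [easy|].
    destruct (below_total HM (eval v x) (eval v y)) as [K|[K|K]]; try easy.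
    now symmetry in K.
Qed.

End Transfer.

Section Comparison.

Variables (M N : structure) (HM : abelian_cog M) (HN : abelian_cog N).

Definition same_signs (v : nat -> M) (w : nat -> N) (l : list form) : Prop :=
  forall f, In f l -> same_sign (fval (rieger_unit HM) (lift HM v) f)
    (fval (rieger_unit HN) (lift HN w) f).

Lemma same_signs_app (v : nat -> M) (w : nat -> N) (l l' : list form) :
  same_signs v w (l ++ l') <-> same_signs v w l /\ same_signs v w l'.
Proof.
unfold same_signs. split.
- intros H. split; intros f Hf; apply H, in_app_iff; auto.
- intros [H K] f [Hf|Hf]%in_app_iff; auto.
Qed.

Lemma same_signs_of (v : nat -> M) (w : nat -> N) (t : term) :
  same_signs v w (signs_of t) ->
  turns HM v t = turns HN w t /\ (eval v t = zero <-> eval w t = zero).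
Proof.
intros H.
assert (K : forall k, (Z.abs k <= Z.of_nat (turns_bound t))%Z ->
  same_sign (((turns HM v t + k)%Z, eval v t) : rieger HM)
    (((turns HN w t + k)%Z, eval w t) : rieger HN)).
{ intros k Hk. pose proof (H (t, k)) as F. rewrite !fval_lift in F. apply F.
  apply in_map_iff. exists (Z.to_nat (k + Z.of_nat (turns_bound t))).
  split; [f_equal; lia|]. apply in_seq. lia. }
pose proof (@turns_range M HM v t) as RM. pose proof (@turns_range N HN w t) as RN.
assert (E : turns HM v t = turns HN w t).
(* Shifting by the turns of one side makes that side nonnegative, hence the other too; the two
   shifts give the two inequalities. *)
{ destruct (K (- turns HM v t)%Z) as [[K1 _] _]; [lia|].
  destruct (K (- turns HN w t)%Z) as [[_ K2] _]; [lia|].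
  simpl in K1, K2. lia. }
split; [easy|].
pose proof (K (- turns HM v t)%Z) as F. rewrite <- E in F.
rewrite Z.add_opp_diag_r in F.
assert (Z : forall (G : structure) (HG : abelian_cog G) (a : G),
  ((0%Z, a) : rieger HG) = zero <-> a = zero).
{ intros G HG a. split; [intros J; now injection J|now intros ->]. }
rewrite <- (Z M HM), <- (Z N HN). apply same_sign_zero, F. lia.
Qed.

Lemma same_signs_extend (v : nat -> M) (w : nat -> N) (l : list form) :
  odivisible (rieger HM) -> odivisible (rieger HN) ->
  same_signs v w (elim ((Var 0, 0%Z) :: (Var 0, (-1)%Z) :: l)) ->
  forall c, exists d, same_signs (scons c v) (scons d w) l.
Proof.
intros DM DN H c.
assert (E : forall (G : structure) (HG : abelian_cog G) (u : nat -> G) (a : G) f,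
  fval (rieger_unit HG) (lift HG (scons a u)) f =
  fval (rieger_unit HG) (scons ((0%Z, a) : rieger HG) (lift HG u)) f).
{ intros G HG u a f. unfold fval. f_equal. apply eval_ext. now intros [|k] _. }
destruct (elim_extension DM DN (@rieger_unit_spos _ HN) H ((0%Z, c) : rieger HM))
  as [d Hd].
(* The two extra forms place [d] between [zero] and the unit, so it comes from an element of [N]. *)
assert (B : d = ((0%Z, snd d) : rieger HN)).
{ apply rieger_box.
  - destruct (Hd (Var 0, 0%Z)) as [[K _] _]; [now left|].
    unfold fval in K. simpl eval in K. rewrite !rieger_add_unit in K.
    simpl in K |- *. lia.
  - pose proof (Hd (Var 0, (-1)%Z) (or_intror (or_introl eq_refl))) as K.
    apply same_sign_opp, same_sign_spos in K. unfold fval in K. cbn [fst snd eval scons] in K.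
    assert (Y : spos (add (rieger_unit HN) (opp d))).
    { apply (spos_eq (x := opp (add d (zmul (-1) (rieger_unit HN))))); [|abel].
      apply K. apply (spos_eq (rieger_box_spos (HG := HM) (a := c))). abel. }
    exact Y. }
exists (snd d). intros f Hf. rewrite !E, <- B. apply Hd. now right; right.
Qed.

End Comparison.

Lemma same_signs_sym (M N : structure) (HM : abelian_cog M) (HN : abelian_cog N)
    (v : nat -> M) (w : nat -> N) (l : list form) :
  same_signs HM HN v w l -> same_signs HN HM w v l.
Proof. intros H f Hf. now apply same_sign_sym, H. Qed.

Lemma sat_transfer (M N : structure) (HM : abelian_cog M) (HN : abelian_cog N)
    (p : formula) :
  odivisible (rieger HM) -> odivisible (rieger HN) ->
  forall (v : nat -> M) (w : nat -> N),
    same_signs HM HN v w (signs p) -> (sat v p <-> sat w p).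
Proof.
intros DM DN.
induction p as [s t|s t u| |p IHp q IHq|p IHp q IHq|p IHp q IHq|p IHp|p IHp];
  intros v w H; cbn [signs] in H; cbn [sat].
- apply same_signs_of in H as [_ H].
  rewrite <- (sub_eq0 HM), <- (sub_eq0 HN). exact H.
- apply same_signs_app in H as [H1 [H2 H3]%same_signs_app].
  apply same_signs_of in H1 as [T1 Z1], H2 as [T2 Z2], H3 as [T3 Z3].
  rewrite (cyc_turns HM), (cyc_turns HN), T1, T2, T3, Z1, Z3. tauto.
- tauto.
- apply same_signs_app in H as [H K]. rewrite (IHp v w H), (IHq v w K). tauto.
- apply same_signs_app in H as [H K]. rewrite (IHp v w H), (IHq v w K). tauto.
- apply same_signs_app in H as [H K]. rewrite (IHp v w H), (IHq v w K). tauto.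
- pose proof (same_signs_sym H) as H'. split; intros K.
  + intros d. destruct (same_signs_extend DN DM H' d) as [c Hc].
    apply (IHp (scons c v)); [now apply same_signs_sym|apply K].
  + intros c. destruct (same_signs_extend DM DN H c) as [d Hd].
    apply (IHp (scons c v) (scons d w)); [easy|apply K].
- pose proof (same_signs_sym H) as H'. split.
  + intros [c K]. destruct (same_signs_extend DM DN H c) as [d Hd].
    exists d. now apply (IHp (scons c v)).
  + intros [d K]. destruct (same_signs_extend DN DM H' d) as [c Hc].
    exists c. apply (IHp (scons c v) (scons d w)); [now apply same_signs_sym|easy].
Qed.

(** ** Signs are determined by quantifier-free formulas *)

Definition Below (s t : term) : formula :=
  Or (Rel Zero s t) (And (Eq s Zero) (Not (Eq t Zero))).

(** One formula for each carry or borrow made while evaluating [t]; together they fix the number of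
    turns in the language of [G]. *)
Fixpoint turns_atoms (t : term) : list formula :=
  match t with
  | Var _ | Zero => []
  | Add s t => Below (Add s t) s :: turns_atoms s ++ turns_atoms t
  | Opp t => Eq t Zero :: turns_atoms t
  end.

Definition sign_atoms (f : form) : list formula :=
  Eq (fst f) Zero :: turns_atoms (fst f).

Definition agree (M N : structure) (v : nat -> M) (w : nat -> N) (l : list formula) : Prop :=
  forall q, In q l -> (sat v q <-> sat w q).

Lemma agree_turns (M N : structure) (HM : abelian_cog M) (HN : abelian_cog N)
    (v : nat -> M) (w : nat -> N) (t : term) :
  agree v w (turns_atoms t) -> turns HM v t = turns HN w t.
Proof.
induction t as [n| |s IHs t IHt|t IHt]; intros H; try easy.
- rewrite !turns_Add, IHs, IHt.
  + f_equal. apply ind_iff. apply (H (Below (Add s t) s)). now left.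
  + intros q Hq. apply H. right. apply in_app_iff. now right.
  + intros q Hq. apply H. right. apply in_app_iff. now left.
- rewrite !turns_Opp, IHt.
  + f_equal. apply ind_iff. apply not_iff_compat. apply (H (Eq t Zero)). now left.
  + intros q Hq. apply H. now right.
Qed.

(** By [fval_lift] the sign of a form depends only on the turns of its term and on whether the term
    vanishes. *)
Lemma agree_same_signs (M N : structure) (HM : abelian_cog M) (HN : abelian_cog N)
    (v : nat -> M) (w : nat -> N) (l : list form) :
  agree v w (flat_map sign_atoms l) -> same_signs HM HN v w l.
Proof.
intros H f Hf.
assert (K : agree v w (sign_atoms f)).
{ intros q Hq. apply H, in_flat_map. now exists f. }
rewrite !fval_lift.
rewrite (@agree_turns M N HM HN v w) by (intros q Hq; apply K; now right).
assert (F : eval v (fst f) = zero <-> eval w (fst f) = zero).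
{ apply (K (Eq (fst f) Zero)). now left. }
split; [easy|].
assert (E : forall (G : structure) (HG : abelian_cog G) (k : Z) (a : G),
  pos (opp ((k, a) : rieger HG)) <-> (0 <= - k - ind (a <> zero))%Z).
{ intros G HG k a. rewrite <- (carry_opp HG). reflexivity. }
rewrite !E. now rewrite (ind_iff (not_iff_compat F)).
Qed.

Lemma quantifier_free_turns_atoms (t : term) (q : formula) :
  In q (turns_atoms t) -> quantifier_free q.
Proof.
induction t as [n| |s IHs t IHt|t IHt]; simpl; try tauto.
- intros [<-|[H|H]%in_app_iff]; auto. simpl. tauto.
- intros [<-|H]; auto. simpl. tauto.
Qed.

Lemma sat_determined (p : formula) : exists l : list formula,
  (forall q, In q l -> quantifier_free q) /\
  forall (M N : structure) (v : nat -> M) (w : nat -> N),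
    c_divisible M -> c_divisible N -> agree v w l -> (sat v p <-> sat w p).
Proof.
exists (flat_map sign_atoms (signs p)). split.
- intros q (f & _ & [<-|H])%in_flat_map; [simpl; tauto|].
  now apply quantifier_free_turns_atoms in H.
- intros M N v w CM CN H.
  apply (sat_transfer (HM := proj1 CM) (HN := proj1 CN)).
  + now apply c_divisible_rieger.
  + now apply c_divisible_rieger.
  + now apply agree_same_signs.
Qed.

(** [Q] is a Boolean function of the truth values of [l], and the formula is its truth table; no
    compactness is involved. The class [K] is a parameter because the induction restricts it to one
    truth value of the first formula. *)
Lemma determined_definable (l : list formula) (Q K : forall M : structure, (nat -> M) -> Prop) :
  (forall q, In q l -> quantifier_free q) ->
  (forall (M N : structure) (v : nat -> M) (w : nat -> N),
     K M v -> K N w -> agree v w l -> (Q M v <-> Q N w)) ->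
  exists q, quantifier_free q /\
    forall (M : structure) (v : nat -> M), K M v -> (Q M v <-> sat v q).
Proof.
revert K. induction l as [|a l IH]; intros K F H.
- destruct (classic (exists (M : structure) (v : nat -> M), K M v /\ Q M v))
    as [(M & v & HK & HQ)|E].
  + exists Top. split; [simpl; tauto|]. intros N w HN. simpl.
    rewrite (H N M w v); [tauto|easy|easy|]. now intros q [].
  + exists Bot. split; [simpl; tauto|]. intros N w HN. simpl. split; [|easy].
    intros HQ. apply E. now exists N, w.
- assert (Fl : forall q, In q l -> quantifier_free q) by (intros; apply F; now right).
  destruct (IH (fun M v => K M v /\ sat v a)) as (q1 & F1 & H1); [easy| |].
  { intros M N v w [HM Ha] [HN Hb] A. apply H; try easy.
    intros q [<-|Hq]; [tauto|auto]. }
  destruct (IH (fun M v => K M v /\ ~ sat v a)) as (q2 & F2 & H2); [easy| |].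
  { intros M N v w [HM Ha] [HN Hb] A. apply H; try easy.
    intros q [<-|Hq]; [tauto|auto]. }
  exists (Or (And a q1) (And (Not a) q2)). split.
  + assert (quantifier_free a) by (apply F; now left). simpl. tauto.
  + intros M v HM. specialize (H1 M v). specialize (H2 M v). simpl.
    destruct (classic (sat v a)); tauto.
Qed.

(** * Quantifier elimination and its consequences *)

Lemma c_divisible_elimination (p : formula) : exists q : formula,
  quantifier_free q /\ (forall k, free k q -> free k p) /\
  forall (M : structure) (v : nat -> M), c_divisible M -> (sat v p <-> sat v q).
Proof.
destruct (sat_determined p) as (l & Fl & H).
destruct (@determined_definable l (fun M v => sat v p) (fun M v => c_divisible M))
  as (q & Fq & E); [easy|intros; now apply H|].
(* [q] may contain variables that are not free in [p]. As [p] does not depend on them, they can be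
   set to [Zero]. *)
pose (s := fun n => if excluded_middle_informative (free n p) then Var n else Zero).
exists (fsubst s q). split; [now apply quantifier_free_fsubst|split].
- intros k (n & Hn)%free_fsubst; [|easy]. unfold s in Hn.
  destruct (excluded_middle_informative (free n p)); simpl in Hn; [now subst|easy].
- intros M v HM. rewrite sat_fsubst, <- E by easy.
  apply sat_ext. intros k Hk. unfold s.
  now destruct (excluded_middle_informative (free k p)).
Qed.

(** Both sides reduce to the same quantifier-free formula evaluated in [M]. As [M] is an arbitrary
    structure, this covers the model completion as well as completeness. *)
Lemma elementary_iff (M N1 N2 : structure) (f1 : M -> N1) (f2 : M -> N2) (p : formula)
    (v : nat -> M) :
  c_divisible N1 -> c_divisible N2 -> embedding f1 -> embedding f2 ->
  (sat (fun n => f1 (v n)) p <-> sat (fun n => f2 (v n)) p).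
Proof.
intros D1 D2 E1 E2. destruct (c_divisible_elimination p) as (q & Fq & _ & H).
rewrite !H by easy. now rewrite <- !sat_embedding.
Qed.

Lemma c_divisible_elementary (M N : structure) (f : M -> N) :
  c_divisible M -> c_divisible N -> embedding f -> elementary_embedding f.
Proof.
intros DM DN Hf p v.
apply (elementary_iff (f1 := fun x => x)); try easy.
Qed.

(** A common substructure of all models, so that sentences have the same truth value in all of
    them. *)
Definition trivial_structure : structure :=
  {| carrier := unit; zero := tt; add := fun _ _ => tt; opp := fun _ => tt;
     cyc := fun _ _ _ => False |}.

Lemma trivial_embedding (M : structure) :
  abelian_cog M -> embedding (fun _ : trivial_structure => zero : M).
Proof.
intros HM. pose proof (cog_abelian HM) as AM.
split; [now intros [] []|split; [easy|split; [|split]]].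
- intros. now rewrite add0l.
- intros. now rewrite opp0.
- intros. simpl. split; [easy|]. intros H. apply (cyc_distinct HM) in H. tauto.
Qed.

Lemma TcD_complete : complete TcD.
Proof.
split; [exists torsion_circle; apply model_TcD, torsion_circle_c_divisible|].
intros p Hp.
assert (E : forall (M N : structure) (v : nat -> M) (w : nat -> N),
  c_divisible M -> c_divisible N -> (sat v p <-> sat w p)).
{ intros M N v w DM DN.
  rewrite (@sat_ext M p v (fun _ => zero)) by (intros k Hk; now destruct (Hp k)).
  rewrite (@sat_ext N p w (fun _ => zero)) by (intros k Hk; now destruct (Hp k)).
  exact (elementary_iff p (fun _ => tt : trivial_structure) DM DN (trivial_embedding (proj1 DM))
    (trivial_embedding (proj1 DN))). }
destruct (classic (entails TcD p)) as [H|H]; [now left|right].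
intros M HM v Hv. apply H. intros N HN w. apply (E M N v w); try easy; now apply model_TcD.
Qed.

Theorem theorem1p1 :
  (complete TcD /\ model_complete TcD) /\
  amalgamation_property TcD /\
  quantifier_elimination TcD /\
  prime_model TcD torsion_circle /\
  (model_completion TcD Tcog /\
   forall G : structure, abelian_cog G ->
     exists (H : structure) (i : G -> H), c_divisible_hull i).
Proof.
split; [split; [exact TcD_complete|]|split; [|split; [|split; [|split; [split; [|split]|]]]]].
- intros M N f HM%model_TcD HN%model_TcD. now apply c_divisible_elementary.
- intros M0 M1 M2 f1 f2 H0%model_TcD H1%model_TcD H2%model_TcD E1 E2.
  destruct (c_divisible_amalgam H0 H1 H2 E1 E2) as (N & g1 & g2 & HN & H).
  exists N, g1, g2. split; [now apply model_TcD|exact H].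
- intros p. destruct (c_divisible_elimination p) as (q & Fq & Lq & H).
  exists q. split; [exact Fq|split; [exact Lq|]].
  intros M HM%model_TcD v. exact (H M v HM).
- split; [apply model_TcD, torsion_circle_c_divisible|].
  intros M HM%model_TcD. pose proof (proj1 HM) as CM.
  destruct (torsion_circle_embedding (rieger_unwinding CM) (proj1 (proj1 CM))
    (c_divisible_rieger (HG := CM) HM)) as [e He].
  exists e. apply c_divisible_elementary; [exact torsion_circle_c_divisible|exact HM|exact He].
- intros M HM%model_TcD. apply model_Tcog, HM.
- intros M HM%model_Tcog. destruct (hull_exists HM) as (H & i & HH & Hi & _).
  exists H, i. split; [now apply model_TcD|].
  exact (c_embedding_embedding HM (proj1 HH) Hi).
- intros M N1 N2 f1 f2 _ H1%model_TcD H2%model_TcD E1 E2 p v.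
  now apply elementary_iff.
- exact hull_exists.
Qed.
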